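(* Let $A\subset\mathbb{D}$ be a Lie subalgebra. There exists a smooth germ $X\subset(\mathbb{C}^n,0)$ with $X\neq\emptyset$ and $X\neq(\mathbb{C}^n,0)$ such that $A=\mathbb{D}_X$ if and only if $A$ is a maximal visible subalgebra of $\mathbb{D}$, i.e. a maximal balanced subalgebra of $\mathbb{D}$.
   Context: $\mathcal{O}_n$ denotes the algebra of germs of holomorphic functions $(\mathbb{C}^n,0)\to\mathbb{C}$, and $\mathbb{D}=\operatorname{Der}\mathcal{O}_n$ the Lie algebra of germs of analytic vector fields on $(\mathbb{C}^n,0)$. A ''germ of analytic variety'' means a reduced (possibly reducible) complex space germ $X\subset(\mathbb{C}^n,0)$; $I_X\subset\mathcal{O}_n$ is the ideal of function germs vanishing on $X$. The tangent algebra of $X$ is $\mathbb{D}_X=\{D\in\mathbb{D}: D(I_X)\subset I_X\}$. For a Lie algebra $B$, a subalgebra $A\subset B$ is called balanced in $B$ if $A$ contains no nonzero ideal of $B$, but $A$ contains an element $a\neq0$ with $[a,B]\subset A$ and $[[a,B],B]\subset A$. A subalgebra is maximal visible in $B$ if it is a maximal element (for inclusion) among balanced subalgebras of $B$. *)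

(* Defs.v *)
From HB Require Import structures.
From mathcomp Require Import all_boot all_order all_algebra.
From mathcomp Require Import complex.
From mathcomp Require Import reals.
Set Implicit Arguments. Unset Strict Implicit. Unset Printing Implicit Defensive.
Import Order.TTheory GRing.Theory Num.Theory.
Local Open Scope ring_scope.

Section Germs.
Variables (R : realType) (n : nat).
Local Notation C := R[i].

Definition mindex := {ffun 'I_n -> nat}.
Definition mdeg (a : mindex) : nat := (\sum_(i < n) a i)%N.
Definition mzero : mindex := [ffun => 0%N].
Definition munit (j : 'I_n) : mindex := [ffun i => (i == j : nat)].
Definition madd (a b : mindex) : mindex := [ffun i => (a i + b i)%N].
Definition msub (a b : mindex) : mindex := [ffun i => (a i - b i)%N].

Definition series := mindex -> C.

(* convergent power series = germs of holomorphic functions at 0 (O_n):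
   the coefficients satisfy a Cauchy estimate |a_alpha| r^|alpha| <= M *)
Definition convergent (f : series) : Prop :=
  exists r : R, exists M : R, 0 < r /\
    forall a : mindex, Normc.normc (f a) * r ^+ mdeg a <= M.

Definition sadd (f g : series) : series := fun a => f a + g a.
Definition sopp (f : series) : series := fun a => - f a.
Definition sscale (c : C) (f : series) : series := fun a => c * f a.
Definition szero : series := fun _ => 0.

Definition smul (f g : series) : series := fun a =>
  \sum_(b : {ffun 'I_n -> 'I_(mdeg a).+1} |
          [forall i, (val (b i) <= a i)%N])
     f [ffun i => val (b i)] * g (msub a [ffun i => val (b i)]).

Definition sderiv (j : 'I_n) (f : series) : series :=
  fun a => (a j).+1%:R * f (madd a (munit j)).

Definition sval0 (f : series) : C := f mzero.

(* vector fields: n-tuples of series; the Lie algebra 𝔻 = Der O_n is the set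
   of those with convergent components *)
Definition vfield := 'I_n -> series.
Definition in_Der (D : vfield) : Prop := forall i, convergent (D i).

Definition vact (D : vfield) (f : series) : series :=
  fun a => \sum_(i < n) smul (D i) (sderiv i f) a.

Definition vadd (D E : vfield) : vfield := fun i => sadd (D i) (E i).
Definition vscale (c : C) (D : vfield) : vfield := fun i => sscale c (D i).
Definition vzero : vfield := fun _ => szero.
Definition vbracket (D E : vfield) : vfield :=
  fun j => sadd (vact D (E j)) (sopp (vact E (D j))).

Definition veq (D E : vfield) : Prop := forall i a, D i a = E i a.

Definition subspace (A : vfield -> Prop) : Prop :=
  (forall D, A D -> in_Der D) /\ A vzero /\
  (forall D E, A D -> A E -> A (vadd D E)) /\
  (forall c D, A D -> A (vscale c D)).

Definition lie_subalgebra (A : vfield -> Prop) : Prop :=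
  subspace A /\ forall D E, A D -> A E -> A (vbracket D E).

Definition lie_ideal (J : vfield -> Prop) : Prop :=
  subspace J /\ forall D E, J D -> in_Der E -> J (vbracket D E).

Definition balanced (A : vfield -> Prop) : Prop :=
  lie_subalgebra A /\
  (forall J, lie_ideal J -> (forall D, J D -> A D) ->
     forall D, J D -> veq D vzero) /\
  (exists a, A a /\ ~ veq a vzero /\
     (forall b, in_Der b -> A (vbracket a b)) /\
     (forall b c, in_Der b -> in_Der c -> A (vbracket (vbracket a b) c))).

Definition maximal_balanced (A : vfield -> Prop) : Prop :=
  balanced A /\
  forall B, balanced B -> (forall D, A D -> B D) -> forall D, B D -> A D.

Definition coord_system (f : 'I_n -> series) : Prop :=
  (forall i, convergent (f i)) /\ (forall i, sval0 (f i) = 0) /\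
  \det (\matrix_(i, j) sval0 (sderiv j (f i))) != 0.

(* I_X for the smooth germ X = {f_0 = ... = f_(k-1) = 0}: the ideal of O_n
   generated by the first k coordinate functions *)
Definition smooth_ideal (f : 'I_n -> series) (k : nat) (g : series) : Prop :=
  convergent g /\
  exists h : 'I_n -> series, (forall i, convergent (h i)) /\
    forall a, g a = \sum_(i < n | (i < k)%N) smul (h i) (f i) a.

Definition tangent_algebra (I : series -> Prop) (D : vfield) : Prop :=
  in_Der D /\ forall g, I g -> I (vact D g).

Definition is_smooth_tangent_algebra (A : vfield -> Prop) : Prop :=
  exists k : nat, (1 <= k <= n)%N /\
  exists f : 'I_n -> series, coord_system f /\
    forall D, A D <-> tangent_algebra (smooth_ideal f k) D.

End Germs.

(* Main.v *)
(* A balanced subalgebra [A] contains [p D] for all vector fields [D] and some nonzero germ [p]: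
   with [a] as in the definition of balanced and [q = a(a(f))], iterated brackets give
   [q c + c(a(f)) a] in [A] for every [c], hence [q a], hence [q^2 c], and [q <> 0] for some [f]
   because [O_n] is reduced of characteristic 0. The germs [p] with [p D <= A] for all [D] form a
   nonzero proper [A]-stable ideal, so the largest [A]-stable ideal [J(A)] inside the maximal
   ideal is nonzero.

   For every Lie algebra [A] of vector fields [J(A)] is the ideal of a smooth germ, the orbit of
   [0] (Nagano). The stabilizer of [J(A)] is an [O_n]-module, so it contains fields [X_s], [s] in
   some [S], with [X_s(x_t) = delta_st] whose values at [0] span those of all its members. Then
   the orbit is the graph [x_j = g_j(x_S)] with Taylor coefficients
   [X_1^a_1 .. X_n^a_n (x_j)(0) / a!]. These series converge by Cauchy estimates,
   [x_j - g_j] lies in [J(A)] because words in the stabilizer can be reordered modulo shorter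
   words, and division by the [x_j - g_j] shows that they generate.

   Hence a maximal balanced [A] is the tangent algebra of its orbit. Conversely, if a balanced [B]
   contains the tangent algebra [D_X] of a smooth germ [X], a germ of order one in [J(B)] and the
   fields [f_l d/df_i] of [D_X] produce the equations [f_l] of [X] in [J(B)], and Nakayama's lemma
   gives [J(B) = I_X], so [B] is contained in [D_X]. *)
Require Import Defs.
From HB Require Import structures.
From mathcomp Require Import all_boot all_order all_algebra.
From mathcomp Require Import complex reals boolp.
From mathcomp Require Import ring lra zify.
Set Implicit Arguments. Unset Strict Implicit. Unset Printing Implicit Defensive.
Import Order.TTheory GRing.Theory Num.Theory.
Local Open Scope ring_scope.

(** * Formal power series *)

Section Multiindices.
Variable n : nat.
Implicit Types a b c : mindex n.

Lemma mindexP a b : (forall i, a i = b i) -> a = b.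
Proof. by move=> h; apply/ffunP. Qed.

Lemma maddE a b i : madd a b i = (a i + b i)%N. Proof. by rewrite ffunE. Qed.
Lemma msubE a b i : msub a b i = (a i - b i)%N. Proof. by rewrite ffunE. Qed.
Lemma munitE (j i : 'I_n) : munit j i = (i == j). Proof. by rewrite ffunE. Qed.
Lemma mzeroE i : mzero n i = 0%N. Proof. by rewrite ffunE. Qed.
Definition mE := (maddE, msubE, munitE, mzeroE).

Lemma leq_mdeg a i : (a i <= mdeg a)%N.
Proof. by rewrite /mdeg (bigD1 i) //= leq_addr. Qed.

Lemma mdegD a b : mdeg (madd a b) = (mdeg a + mdeg b)%N.
Proof. by rewrite /mdeg -big_split /=; apply: eq_bigr => i _; rewrite mE. Qed.

Lemma mdeg0 : mdeg (mzero n) = 0%N.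
Proof. by rewrite /mdeg big1 // => i _; rewrite mE. Qed.

Lemma mdeg_eq0 a : (mdeg a == 0%N) = (a == mzero n).
Proof.
apply/eqP/eqP => [h|->]; last exact: mdeg0.
by apply: mindexP => i; rewrite mE; have := leq_mdeg a i; rewrite h leqn0 => /eqP.
Qed.

Lemma mdeg_gt0 a : (0 < mdeg a)%N -> exists j, (0 < a j)%N.
Proof.
move=> a0; apply: contrapT => h; move: a0; rewrite /mdeg big1 // => i _.
by apply/eqP; rewrite -leqn0 leqNgt; apply/negP => ai; apply: h; exists i.
Qed.

Lemma mdeg_unit j : mdeg (munit j : mindex n) = 1%N.
Proof.
rewrite /mdeg (bigD1 j) //= big1 => [|i /negPf ij]; first by rewrite mE eqxx.
by rewrite mE ij.
Qed.

Lemma maddC a b : madd a b = madd b a.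
Proof. by apply: mindexP => i; rewrite !mE addnC. Qed.

Lemma madd0 a : madd (mzero n) a = a.
Proof. by apply: mindexP => i; rewrite !mE. Qed.

Lemma madd_subK a j : (0 < a j)%N -> madd (msub a (munit j)) (munit j) = a.
Proof.
move=> aj; apply: mindexP => i; rewrite !mE.
have [->|_] /= := eqVneq i j; last by rewrite subn0 addn0.
by rewrite subnK.
Qed.

Lemma msub_addK a b : msub (madd a b) b = a.
Proof. by apply: mindexP => i; rewrite !mE addnK. Qed.

Lemma mdeg_sub a b : (forall i, b i <= a i)%N -> (mdeg b + mdeg (msub a b) = mdeg a)%N.
Proof.
by move=> h; rewrite -mdegD; congr mdeg; apply: mindexP => i; rewrite !mE subnKC.
Qed.

(** Big sums need a finite index type, so multi-indices with entries at most [N] are encoded as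
    functions into ['I_N.+1]. Because of [inord], [tobox] is faithful only on those. *)
Definition boxval N (b : {ffun 'I_n -> 'I_N.+1}) : mindex n := [ffun i => val (b i)].
Definition tobox N (a : mindex n) : {ffun 'I_n -> 'I_N.+1} := [ffun i => inord (a i)].

Lemma boxvalE N (b : {ffun 'I_n -> 'I_N.+1}) i : boxval b i = b i.
Proof. by rewrite ffunE. Qed.

Lemma boxvalK N : cancel (@boxval N) (@tobox N).
Proof. by move=> b; apply/ffunP => i; rewrite !ffunE inord_val. Qed.

Lemma toboxK N a : (forall i, a i <= N)%N -> boxval (tobox N a) = a.
Proof. by move=> h; apply: mindexP => i; rewrite !ffunE /= inordK ?ltnS. Qed.

Lemma boxval_inj N : injective (@boxval N).
Proof. exact: can_inj (@boxvalK N). Qed.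

End Multiindices.

(** * The ring of formal power series and its partial derivatives *)

Section PowerSeriesRing.
Variables (R : realType) (n : nat).
Local Notation C := R[i].

Definition fps := series R n.
Implicit Types (f g h : fps) (a b : mindex n).

(* Convolution summed over an arbitrary large enough box of exponents. *)
Definition boxsum N a (F : mindex n -> C) : C :=
  \sum_(b : {ffun 'I_n -> 'I_N.+1} | [forall i, (boxval b i <= a i)%N]) F (boxval b).

(** In [smul] the box depends on the exponent; enlarging it freely lets convolutions at different
    exponents share one index type. *)
Lemma boxsum_indep M N a (F : mindex n -> C) :
  (forall i, a i <= M)%N -> (forall i, a i <= N)%N -> boxsum M a F = boxsum N a F.
Proof.
move=> hM hN; rewrite /boxsum.
have tr P (b : {ffun 'I_n -> 'I_P.+1}) Q : (forall i, a i <= Q)%N ->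
    [forall i, (boxval b i <= a i)%N] -> boxval (tobox Q (boxval b)) = boxval b.
  by move=> hQ /forallP hb; rewrite toboxK // => i; apply: leq_trans (hb i) (hQ i).
rewrite (reindex_onto (fun b : {ffun 'I_n -> 'I_N.+1} => tobox M (boxval b))
                      (fun b : {ffun 'I_n -> 'I_M.+1} => tobox N (boxval b))) /=; last first.
  by move=> b hb; rewrite tr // boxvalK.
apply: eq_big => [b|b /andP[hb /eqP e]].
  apply/andP/idP => [[hb /eqP <-]|hb]; last by rewrite !tr // boxvalK eqxx.
  by rewrite tr.
by congr F; rewrite -[in RHS]e [in RHS]tr.
Qed.

Lemma eq_boxsum N a (F G : mindex n -> C) :
  (forall b, (forall i, b i <= a i)%N -> F b = G b) -> boxsum N a F = boxsum N a G.
Proof. by move=> h; apply: eq_bigr => b /forallP hb; apply: h. Qed.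

Lemma boxsum1 N a (c : mindex n) (F : mindex n -> C) : (forall i, a i <= N)%N ->
  (forall i, c i <= a i)%N -> (forall b, (forall i, b i <= a i)%N -> b != c -> F b = 0) ->
  boxsum N a F = F c.
Proof.
move=> hN hc h; have cN i : (c i <= N)%N := leq_trans (hc i) (hN i).
rewrite /boxsum (bigD1 (tobox N c)) /= ?toboxK //; last by apply/forallP.
rewrite big1 ?addr0 // => b /andP[/forallP hb hbc]; apply: h => //.
by apply: contra hbc => /eqP <-; rewrite boxvalK.
Qed.

Lemma boxsum_rev N a (F : mindex n -> C) : (forall i, a i <= N)%N ->
  boxsum N a F = boxsum N a (fun b => F (msub a b)).
Proof.
move=> hN; rewrite /boxsum.
have le b i : (msub a b i <= a i)%N by rewrite mE leq_subr.
have leN b i : (msub a b i <= N)%N := leq_trans (le b i) (hN i).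
have inv b : [forall i, (b i <= a i)%N] -> msub a (msub a b) = b.
  by move=> /forallP hb; apply: mindexP => i; rewrite !mE subKn.
rewrite (reindex_onto (fun b : {ffun 'I_n -> 'I_N.+1} => tobox N (msub a (boxval b)))
                      (fun b : {ffun 'I_n -> 'I_N.+1} => tobox N (msub a (boxval b)))) /=; last first.
  by move=> b hb; rewrite toboxK // inv // boxvalK.
apply: eq_big => [b|b _]; last by rewrite toboxK.
rewrite toboxK //; apply/andP/idP => [[_ /eqP <-]|hb].
  by rewrite toboxK //; apply/forallP => i; apply: le.
by rewrite inv // boxvalK eqxx; split=> //; apply/forallP.
Qed.

(* Both sides sum [F] over the pairs [(c, d)] with [c + d <= a]. *)
Lemma boxsum_triangle N a (F : mindex n -> mindex n -> C) : (forall i, a i <= N)%N ->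
  boxsum N a (fun b => boxsum N b (fun c => F c (msub b c))) =
  boxsum N a (fun c => boxsum N (msub a c) (fun d => F c d)).
Proof.
move=> hN; rewrite /boxsum.
rewrite (exchange_big_dep (fun c : {ffun 'I_n -> 'I_N.+1} => [forall i, (boxval c i <= a i)%N])) /=;
  last first.
  move=> b c /forallP hb /forallP hc; apply/forallP => i; exact: leq_trans (hc i) (hb i).
apply: eq_bigr => c /forallP hc.
have leN (d : mindex n) : [forall i, (d i <= msub a (boxval c) i)%N] ->
    forall i, (madd (boxval c) d i <= N)%N.
  by move=> /forallP hd i; have := hd i; have := hc i; have := hN i; rewrite !mE; lia.
have leN' (b : mindex n) : [forall i, (b i <= a i)%N] ->
    forall i, (msub b (boxval c) i <= N)%N.
  by move=> /forallP hb i; have := hb i; have := hN i; rewrite !mE; lia.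
rewrite (reindex_onto (fun d : {ffun 'I_n -> 'I_N.+1} => tobox N (madd (boxval c) (boxval d)))
                      (fun b : {ffun 'I_n -> 'I_N.+1} => tobox N (msub (boxval b) (boxval c)))) /=; last first.
  move=> b /andP[hb /forallP hcb]; rewrite toboxK; last exact: leN'.
  apply: boxval_inj; rewrite toboxK => [|i].
    by apply: mindexP => i; have := hcb i; rewrite !mE; lia.
  by have := hcb i; have := forallP hb i; have := hN i; rewrite !mE; lia.
apply: eq_big => [d|d]; last first.
  move=> /andP[/andP[/forallP h1 /forallP h2] /eqP e]; congr F.
  by rewrite -[in RHS]e [in RHS]toboxK // => i; apply: leN'; apply/forallP.
apply/idP/idP => [/andP[/andP[h1 /forallP h2] /eqP e]|hd].
  apply/forallP => i; rewrite -e toboxK; last exact: leN'.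
  by have := forallP h1 i; rewrite !mE; lia.
have e : boxval (tobox N (madd (boxval c) (boxval d))) = madd (boxval c) (boxval d).
  by rewrite toboxK //; exact: leN.
rewrite !e maddC msub_addK boxvalK eqxx andbT; apply/andP; split; apply/forallP => i.
  by have := forallP hd i; have := hc i; rewrite !mE; lia.
by rewrite !mE; lia.
Qed.

Lemma smul_boxsum N f g a : (forall i, a i <= N)%N ->
  smul f g a = boxsum N a (fun b => f b * g (msub a b)).
Proof.
move=> hN; rewrite -(@boxsum_indep (mdeg a)) //; last exact: leq_mdeg.
apply: eq_bigl => b; apply: eq_forallb => i; by rewrite ffunE.
Qed.

Lemma fps_smulA : associative (@smul R n).
Proof.
move=> f g h; apply: funext => a; pose N := mdeg a; have hN := @leq_mdeg n a.
rewrite !(smul_boxsum _ _ hN); symmetry.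
pose F c d := f c * g d * h (msub (msub a c) d).
transitivity (boxsum N a (fun b => boxsum N b (fun c => F c (msub b c)))).
  apply: eq_boxsum => b hb; rewrite (@smul_boxsum N) => [|i]; last exact: leq_trans (hb i) (hN i).
  rewrite /boxsum mulr_suml; apply: eq_bigr => c /forallP hc; rewrite /F; congr (_ * h _).
  by apply: mindexP => i; have := hc i; have := hb i; rewrite !mE; lia.
rewrite boxsum_triangle //; apply: eq_boxsum => c hc.
rewrite (@smul_boxsum N) => [|i]; last by rewrite mE; have := hN i; rewrite /N; lia.
by rewrite /boxsum mulr_sumr; apply: eq_bigr => d _; rewrite /F mulrA.
Qed.

Lemma fps_smulC : commutative (@smul R n).
Proof.
move=> f g; apply: funext => a; have hN := @leq_mdeg n a.
rewrite !(smul_boxsum _ _ hN) boxsum_rev //; apply: eq_boxsum => b hb; rewrite mulrC.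
by congr (g _ * _); apply: mindexP => i; have := hb i; rewrite !mE; lia.
Qed.

Definition polC (c : C) : fps := fun a => if a == mzero n then c else 0.

Lemma smul_polC c f a : smul (polC c) f a = c * f a.
Proof.
rewrite (smul_boxsum _ _ (@leq_mdeg n a)) (@boxsum1 _ _ (mzero n)).
- by rewrite /polC eqxx; congr (_ * f _); apply: mindexP => i; rewrite !mE subn0.
- exact: leq_mdeg.
- by move=> i; rewrite mE.
- by move=> b _ /negPf; rewrite /polC => ->; rewrite mul0r.
Qed.

Lemma fps_smul1 : left_id (polC 1) (@smul R n).
Proof. by move=> f; apply: funext => a; rewrite smul_polC mul1r. Qed.

Lemma fps_smulDl : left_distributive (@smul R n) (@sadd R n).
Proof.
move=> f g h; apply: funext => a; rewrite /sadd -big_split /=.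
by apply: eq_bigr => b _; rewrite mulrDl.
Qed.

HB.instance Definition _ := gen_eqMixin fps.
HB.instance Definition _ := gen_choiceMixin fps.

Let saddA : associative (@sadd R n).
Proof. by move=> f g h; apply: funext => a; rewrite /sadd addrA. Qed.
Let saddC : commutative (@sadd R n).
Proof. by move=> f g; apply: funext => a; rewrite /sadd addrC. Qed.
Let sadd0 : left_id (@szero R n) (@sadd R n).
Proof. by move=> f; apply: funext => a; rewrite /sadd add0r. Qed.
Let saddN : left_inverse (@szero R n) (@sopp R n) (@sadd R n).
Proof. by move=> f; apply: funext => a; rewrite /sadd addNr. Qed.
HB.instance Definition _ := GRing.isZmodule.Build fps saddA saddC sadd0 saddN.

Let sone_neq0 : polC 1 != 0 :> fps.
Proof.
apply/eqP => /(congr1 (fun f : fps => f (mzero n))) /eqP.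
by rewrite /polC eqxx oner_eq0.
Qed.
HB.instance Definition _ := GRing.Zmodule_isComNzRing.Build fps
  fps_smulA fps_smulC fps_smul1 fps_smulDl sone_neq0.

Lemma fpsDE f g a : (f + g) a = f a + g a. Proof. by []. Qed.
Lemma fpsNE f a : (- f) a = - f a. Proof. by []. Qed.
Lemma fps0E a : (0 : fps) a = 0. Proof. by []. Qed.
Lemma fps_sumE I (r : seq I) (P : pred I) (F : I -> fps) a :
  (\sum_(i <- r | P i) F i) a = \sum_(i <- r | P i) F i a.
Proof. by elim/big_rec2: _ => // i x y _ <-. Qed.
Lemma fpsME f g a N : (forall i, a i <= N)%N ->
  (f * g) a = boxsum N a (fun b => f b * g (msub a b)).
Proof. exact: smul_boxsum. Qed.

Lemma polCM c f a : (polC c * f) a = c * f a. Proof. exact: smul_polC. Qed.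
Lemma sscaleE c f : sscale c f = polC c * f.
Proof. by apply: funext => a; rewrite polCM. Qed.
Lemma polC1 : polC 1 = 1. Proof. by []. Qed.
Lemma polC_mul c d : polC (c * d) = polC c * polC d.
Proof. by apply: funext => a; rewrite polCM /polC; case: ifP => // _; rewrite mulr0. Qed.
Lemma polC0 : polC 0 = 0. Proof. by apply: funext => a; rewrite /polC if_same. Qed.
Lemma polCD c d : polC (c + d) = polC c + polC d.
Proof. by apply: funext => a; rewrite fpsDE /polC; case: ifP => // _; rewrite addr0. Qed.
Lemma polC_nat k : polC k%:R = k%:R.
Proof. by elim: k => [|k IH]; rewrite ?polC0 // -addn1 !natrD polCD IH. Qed.

Definition ev0 (f : fps) : C := f (mzero n).
Let ev0_sub : zmod_morphism ev0. Proof. by []. Qed.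
HB.instance Definition _ := GRing.isZmodMorphism.Build fps C ev0 ev0_sub.
Let ev0_mul : monoid_morphism ev0.
Proof.
split=> [|f g]; first by rewrite /ev0 -polC1 /polC eqxx.
have le0 i : (mzero n i <= 0)%N by rewrite mE.
rewrite /ev0 (fpsME _ _ le0) (@boxsum1 _ _ (mzero n)) //.
  by congr (_ * g _); apply: mindexP => i; rewrite !mE.
move=> b hb /eqP[]; apply: mindexP => i; have := hb i; rewrite !mE; lia.
Qed.
HB.instance Definition _ := GRing.isMonoidMorphism.Build fps C ev0 ev0_mul.
Lemma ev0_polC c : ev0 (polC c) = c. Proof. by rewrite /ev0 /polC eqxx. Qed.

Definition Xvar (j : 'I_n) : fps := fun a => (a == munit j)%:R.

Lemma ev0_Xvar j : ev0 (Xvar j) = 0.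
Proof.
rewrite /ev0 /Xvar; case: eqP => // /(congr1 (@mdeg n)).
by rewrite mdeg0 mdeg_unit.
Qed.

Lemma XvarM_pos j f a : (Xvar j * f) (madd a (munit j)) = f a.
Proof.
rewrite (fpsME _ _ (@leq_mdeg n _)) (@boxsum1 _ _ (munit j)).
- by rewrite msub_addK /Xvar eqxx mul1r.
- exact: leq_mdeg.
- by move=> i; rewrite !mE; lia.
- by move=> b _ /negPf; rewrite /Xvar => ->; rewrite mul0r.
Qed.

Lemma XvarM_zero j f a : a j = 0%N -> (Xvar j * f) a = 0.
Proof.
move=> aj; rewrite (fpsME _ _ (@leq_mdeg n _)) /boxsum big1 // => b /forallP hb.
rewrite /Xvar; case: eqP => [e|_]; last by rewrite mul0r.
by have := hb j; rewrite e !mE eqxx aj.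
Qed.

Lemma Xvar_inj j f g : Xvar j * f = Xvar j * g -> f = g.
Proof. by move=> e; apply: funext => a; rewrite -(XvarM_pos j) e XvarM_pos. Qed.

Definition pd (j : 'I_n) : fps -> fps := sderiv j.
Lemma pdE j f a : pd j f a = (a j).+1%:R * f (madd a (munit j)). Proof. by []. Qed.

Let pd_sub j : zmod_morphism (pd j).
Proof. by move=> f g; apply: funext => a; rewrite !(fpsDE, fpsNE, pdE) mulrBr. Qed.
HB.instance Definition _ j := GRing.isZmodMorphism.Build fps fps (pd j) (pd_sub j).

Lemma Xvar_pd j f a : (Xvar j * pd j f) a = (a j)%:R * f a.
Proof.
have [aj|aj] := posnP (a j); first by rewrite XvarM_zero // aj mul0r.
rewrite -{1 3}(madd_subK aj) XvarM_pos pdE; congr (_ %:R * f _).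
by rewrite !mE eqxx; lia.
Qed.

Lemma pdM j f g : pd j (f * g) = pd j f * g + f * pd j g.
Proof.
(* Checked after multiplying by [X_j], where [X_j d_j] is the Euler operator. *)
apply: (@Xvar_inj j); rewrite mulrDr mulrA (mulrCA _ f); apply: funext => a.
have hN := @leq_mdeg n a.
rewrite Xvar_pd fpsDE !(fpsME _ _ hN) /boxsum mulr_sumr -big_split /=.
apply: eq_bigr => b /forallP hb; rewrite !Xvar_pd mE.
have -> : (a j = boxval b j + (a j - boxval b j))%N by have := hb j; lia.
by rewrite addKn natrD; ring.
Qed.

Lemma pd1 j : pd j 1 = 0.
Proof.
have := pdM j 1 1; rewrite !mulr1 mul1r => /eqP; rewrite -subr_eq0 opprD addrA subrr sub0r.
by rewrite oppr_eq0 => /eqP.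
Qed.

Lemma pd_polC j c : pd j (polC c) = 0.
Proof.
apply: funext => a; rewrite pdE /polC; case: eqP => [/(congr1 (@mdeg n))|_]; last by rewrite mulr0.
by rewrite mdegD mdeg_unit mdeg0 addn1.
Qed.

Lemma pd_Xvar i j : pd i (Xvar j) = (i == j)%:R.
Proof.
apply: funext => a; rewrite pdE /Xvar; have [<-|ij] := eqVneq i j.
  have -> : (madd a (munit i) == munit i) = (a == mzero n).
    apply/eqP/eqP => [e|->]; last by rewrite madd0.
    by rewrite -(msub_addK a (munit i)) e; apply: mindexP => k; rewrite !mE subnn.
  rewrite (_ : (true%:R : fps) a = polC 1 a) // /polC.
  by case: eqP => [->|_]; rewrite ?mulr0 // mE mulr1.
case: eqP => [/(congr1 (fun b : mindex n => b i))|_]; last by rewrite mulr0.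
by rewrite !mE eqxx (negPf ij) addn1.
Qed.

Lemma pdC i j f : pd i (pd j f) = pd j (pd i f).
Proof.
apply: funext => a; rewrite !pdE !mE !mulrA; congr (_ * f _); last first.
  by apply: mindexP => k; rewrite !mE addnAC.
rewrite -!natrM; congr (_%:R); have [->|] := eqVneq i j; rewrite ?eqxx //.
by rewrite !addn0 mulnC.
Qed.

End PowerSeriesRing.

(** * Cauchy estimates and division *)

Section Majorants.
Variables (R : realType) (n : nat).
Local Notation C := R[i].
Local Notation fps := (fps R n).
Local Notation conv := (@convergent R n).
Implicit Types (f g h : fps) (a b : mindex n).
Local Notation nc := (@Normc.normc R).

Lemma nc_ge0 (x : C) : 0 <= nc x.
Proof. by case: x => x y; apply: sqrtr_ge0. Qed.

Lemma nc_sum I (r : seq I) (P : pred I) (F : I -> C) :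
  nc (\sum_(i <- r | P i) F i) <= \sum_(i <- r | P i) nc (F i).
Proof.
elim/big_rec2: _ => [|i x y _ h]; first by rewrite Normc.normc0.
exact: le_trans (le_normcD _ _) (lerD _ _).
Qed.

Lemma nc_nat k : nc k%:R = k%:R.
Proof. by rewrite normcMn Normc.normc1. Qed.

(** The coefficient of $x^a$ in $\prod_i (1-x_i)^{-(q+1)}$. *)
Definition bw q a : nat := (\prod_(i < n) 'C(a i + q, q))%N.

Lemma bw0 a : bw 0 a = 1%N.
Proof. by apply: big1 => i _; rewrite bin0. Qed.

Lemma hockey_stick q m : (\sum_(k < m.+1) 'C(k + q, q) = 'C(m + q.+1, q.+1))%N.
Proof.
elim: m => [|m IH]; first by rewrite big_ord_recr big_ord0 /= !add0n !binn.
by rewrite big_ord_recr IH /= !addSn !addnS binS.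
Qed.

(** Multiplying the generating function by $\prod_i (1-x_i)^{-1}$ raises every exponent by one; the
    box sum factors into one-variable hockey-stick sums. *)
Lemma bw_boxsum N q a : (forall i, a i <= N)%N ->
  (\sum_(b : {ffun 'I_n -> 'I_N.+1} | [forall i, (boxval b i <= a i)%N]) bw q (boxval b)
   = bw q.+1 a)%N.
Proof.
move=> hN; pose F (i : 'I_n) (k : 'I_N.+1) := 'C(k + q, q).
transitivity (\prod_(i < n) \sum_(k < N.+1 | (k <= a i)%N) F i k)%N; last first.
  apply: eq_bigr => i _; rewrite -hockey_stick.
  rewrite (big_ord_widen N.+1 (fun k => 'C(k + q, q))) ?ltnS //.
rewrite bigA_distr_big_dep; apply: eq_big => [b|b _].
  by apply: eq_forallb => i; rewrite boxvalE.
by apply: eq_bigr => i _; rewrite boxvalE.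
Qed.

Lemma bin_leq_exp2 m k : ('C(m, k) <= 2 ^ m)%N.
Proof.
elim: m k => [|m IH] [|k] //; first by rewrite bin0 expn_gt0.
by rewrite binS expnS mul2n -addnn leq_add.
Qed.

Lemma bw_leq q a : (bw q a <= 2 ^ (mdeg a + n * q))%N.
Proof.
rewrite /mdeg -[n in (n * q)%N]card_ord -sum_nat_const -big_split /=.
by rewrite expn_sum; apply: leq_prod => i _; apply: bin_leq_exp2.
Qed.

(** The factor in $x_j$ obeys the derivative rule for $(1-x_j)^{-(q+1)}$ exactly; in the other
    factors raising [q] only increases the binomials. *)
Lemma bw_unit q a j : ((a j).+1 * bw q (madd a (munit j)) <= q.+1 * bw q.+1 a)%N.
Proof.
rewrite /bw (bigD1 j) // [in leqRHS](bigD1 j) //= !mulnA; apply: leq_mul.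
  rewrite !mE eqxx addn1 addSn addnS -!addSn.
  rewrite mul_bin_left; have -> : ((a j).+1 + q - q)%N = (a j).+1 by lia.
  by rewrite mulnC.
apply: leq_prod => i /negPf ij; rewrite !mE ij addn0 addnS binS; exact: leq_addl.
Qed.

(** Domination by $D \prod_i (1-Kx_i)^{-(q+1)}$. A derivative, or a product with a series of weight
    0, raises [q] by one and keeps [K], so iterated derivations do not shrink the radius. *)
Definition maj (q : nat) (K D : R) f : Prop :=
  forall a, nc (f a) <= D * K ^+ mdeg a * (bw q a)%:R.

Lemma majW q K K' D D' f : 0 <= K -> 0 <= D -> K <= K' -> D <= D' ->
  maj q K D f -> maj q K' D' f.
Proof.
move=> K0 D0 KK DD hf a; apply: le_trans (hf a) _; apply: ler_wpM2r; first exact: ler0n.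
by apply: ler_pM => //; [apply: exprn_ge0 | apply: lerXn2r; rewrite ?nnegrE // (le_trans K0)].
Qed.

Lemma majD q K D E f g : maj q K D f -> maj q K E g -> maj q K (D + E) (f + g).
Proof.
move=> hf hg a; rewrite fpsDE !mulrDl.
exact: le_trans (le_normcD _ _) (lerD _ _).
Qed.

Lemma maj_sum q K D I (r : seq I) (F : I -> fps) :
  (forall i, maj q K D (F i)) -> maj q K ((size r)%:R * D) (\sum_(i <- r) F i).
Proof.
move=> h; elim: r => [|i r IH] a.
  by rewrite big_nil fps0E Normc.normc0 !mul0r.
rewrite big_cons -[(size _)%:R]/((size r).+1%:R) -natr1 addrC mulrDl mul1r.
exact: majD.
Qed.

Lemma majM q K D E f g : 0 <= K -> 0 <= D -> 0 <= E ->
  maj q K D f -> maj 0 K E g -> maj q.+1 K (D * E) (f * g).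
Proof.
move=> K0 D0 E0 hf hg a; have hN := @leq_mdeg n a.
rewrite (fpsME _ _ hN) -(bw_boxsum _ hN) natr_sum mulr_sumr.
apply: le_trans (nc_sum _ _ _) _; apply: ler_sum => b /forallP hb.
rewrite Normc.normcM.
have -> : K ^+ mdeg a = K ^+ mdeg (boxval b) * K ^+ mdeg (msub a (boxval b)).
  by rewrite -exprD mdeg_sub.
apply: le_trans (_ : _ <= (D * K ^+ mdeg (boxval b) * (bw q (boxval b))%:R) *
   (E * K ^+ mdeg (msub a (boxval b)) * 1)) _.
  apply: ler_pM => //; [exact: nc_ge0 | exact: nc_ge0 |].
  by have := hg (msub a (boxval b)); rewrite bw0.
by rewrite le_eqVlt; apply/orP; left; apply/eqP; ring.
Qed.

Lemma maj_pd q K D f j : 0 <= K -> 0 <= D ->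
  maj q K D f -> maj q.+1 K (q.+1%:R * K * D) (pd j f).
Proof.
move=> K0 D0 hf a; rewrite pdE Normc.normcM nc_nat.
apply: le_trans (ler_wpM2l (ler0n _ _) (hf _)) _.
rewrite mdegD mdeg_unit exprD expr1.
set x := K ^+ _; have x0 : 0 <= x by apply: exprn_ge0.
have -> : (a j).+1%:R * (D * (x * K) * (bw q (madd a (munit j)))%:R) =
   (D * x * K) * ((a j).+1 * bw q (madd a (munit j)))%:R by rewrite natrM; ring.
have -> : q.+1%:R * K * D * x * (bw q.+1 a)%:R = (D * x * K) * (q.+1 * bw q.+1 a)%:R.
  by rewrite natrM; ring.
by apply: ler_wpM2l; [rewrite !mulr_ge0 | rewrite ler_nat bw_unit].
Qed.

Lemma maj_convergent q K D f : 1 <= K -> maj q K D f -> conv f.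
Proof.
move=> K1 hf; have K0 : 0 < K := lt_le_trans ltr01 K1.
have D0 : 0 <= D.
  have := le_trans (nc_ge0 _) (hf (mzero n)).
  by rewrite mdeg0 expr0 mulr1 /bw big1 ?mulr1 // => i _; rewrite mE binn.
(* The weight is at most $2^{|a|+nq}$: halving the radius absorbs $2^{|a|}$, and the bound absorbs
   $2^{nq}$. *)
exists (2 * K)^-1; exists (D * 2 ^+ (n * q)); split; first by rewrite invr_gt0 mulr_gt0.
move=> a; rewrite exprVn ler_pdivrMr ?exprn_gt0 ?mulr_gt0 //.
apply: le_trans (hf a) _.
apply: le_trans (_ : _ <= D * K ^+ mdeg a * (2 ^ (mdeg a + n * q))%:R) _.
  apply: ler_wpM2l; last by rewrite ler_nat bw_leq.
  by rewrite mulr_ge0 // exprn_ge0 // ltW.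
by rewrite natrX exprD exprMn le_eqVlt; apply/orP; left; apply/eqP; ring.
Qed.

Lemma convergent_maj f : conv f -> exists K D, [/\ 1 <= K, 1 <= D & maj 0 K D f].
Proof.
move=> [r [M [r0 h]]]; have ri : 0 < r^-1 by rewrite invr_gt0.
have M0 : 0 <= M by apply: le_trans (h (mzero n)); rewrite mulr_ge0 ?nc_ge0 ?exprn_ge0 ?ltW.
exists (1 + r^-1), (1 + M); split; [lra|lra|] => a.
apply: (@majW 0 r^-1 (1 + r^-1) M (1 + M)); [lra|lra|lra|lra|] => {}a.
by rewrite bw0 mulr1 exprVn ler_pdivlMr ?exprn_gt0.
Qed.

Lemma convergent_maj2 f g : conv f -> conv g ->
  exists K D, [/\ 1 <= K, 1 <= D, maj 0 K D f & maj 0 K D g].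
Proof.
move=> /convergent_maj[K [D [K1 D1 hf]]] /convergent_maj[K' [D' [K1' D1' hg]]].
exists (K + K'), (D + D'); split; [lra|lra| |].
  by apply: majW hf; lra.
by apply: majW hg; lra.
Qed.

Lemma convergent_maj_fam (T : finType) (F : T -> fps) : (forall i, conv (F i)) ->
  exists K D, [/\ 1 <= K, 1 <= D & forall i, maj 0 K D (F i)].
Proof.
move=> cF; suff H (r : seq T) : exists K D, [/\ 1 <= K, 1 <= D & forall i, i \in r -> maj 0 K D (F i)].
  by have [K [D [K1 D1 h]]] := H (enum T); exists K, D; split=> // i; apply: h; rewrite mem_enum.
elim: r => [|j r [K [D [K1 D1 h]]]]; first by exists 1, 1; split.
have [K' [D' [K1' D1' hj]]] := convergent_maj (cF j).
exists (K + K'), (D + D'); split; [lra|lra|] => i.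
rewrite inE => /predU1P[->|/h hi]; first by apply: majW hj; lra.
by apply: majW hi; lra.
Qed.

Lemma convM f g : conv f -> conv g -> conv (f * g).
Proof.
move=> hf hg; have [K [D [K1 D1 h1 h2]]] := convergent_maj2 hf hg.
by apply: (@maj_convergent 1 K (D * D)) => //; apply: majM => //; lra.
Qed.

Lemma convD f g : conv f -> conv g -> conv (f + g).
Proof.
move=> hf hg; have [K [D [K1 D1 h1 h2]]] := convergent_maj2 hf hg.
exact: (@maj_convergent 0 K (D + D) _ K1 (majD h1 h2)).
Qed.

Lemma conv_pd j f : conv f -> conv (pd j f).
Proof.
move=> /convergent_maj[K [D [K1 D1 hf]]].
by apply: (@maj_convergent 1 K (1 * K * D)) => //; apply: maj_pd => //; lra.
Qed.

Lemma conv_polC c : conv (polC c : fps).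
Proof.
exists 1, (nc c); split=> // a; rewrite expr1n mulr1 /polC.
by case: ifP => // _; rewrite Normc.normc0 nc_ge0.
Qed.

Lemma conv0 : conv (0 : fps). Proof. by rewrite -polC0; apply: conv_polC. Qed.
Lemma conv1 : conv (1 : fps). Proof. exact: conv_polC. Qed.
Lemma conv_nat k : conv (k%:R : fps). Proof. by rewrite -polC_nat; apply: conv_polC. Qed.

Lemma convN f : conv f -> conv (- f).
Proof. by move=> [r [M [r0 h]]]; exists r, M; split=> // a; rewrite fpsNE normcN. Qed.

Lemma convB f g : conv f -> conv g -> conv (f - g).
Proof. by move=> hf hg; apply: convD => //; apply: convN. Qed.

Lemma conv_Xvar j : conv (Xvar R j).
Proof.
exists 1, 1; split=> // a; rewrite expr1n mulr1 /Xvar; case: eqP => _.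
  by rewrite Normc.normc1.
by rewrite Normc.normc0.
Qed.

Lemma conv_sum I (r : seq I) (P : pred I) (F : I -> fps) :
  (forall i, P i -> conv (F i)) -> conv (\sum_(i <- r | P i) F i).
Proof. by move=> h; elim/big_ind: _ => //; [exact: conv0 | exact: convD]. Qed.

Lemma conv_prod I (r : seq I) (P : pred I) (F : I -> fps) :
  (forall i, P i -> conv (F i)) -> conv (\prod_(i <- r | P i) F i).
Proof. by move=> h; elim/big_ind: _ => //; [exact: conv1 | exact: convM]. Qed.

Lemma convX f k : conv f -> conv (f ^+ k).
Proof. by move=> h; elim: k => [|k IH]; [exact: conv1 | rewrite exprS; apply: convM]. Qed.

Lemma conv_det m (M : 'M[fps]_m) : (forall i j, conv (M i j)) -> conv (\det M).
Proof.
move=> h; apply: conv_sum => s _; apply: convM; last by apply: conv_prod => i _.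
by apply: convX; apply: convN; apply: conv1.
Qed.

Lemma conv_adj m (M : 'M[fps]_m) :
  (forall i j, conv (M i j)) -> forall i j, conv (\adj M i j).
Proof.
move=> h i j; rewrite mxE; apply: convM; first by apply: convX; apply: convN; apply: conv1.
by apply: conv_det => k l; rewrite !mxE.
Qed.

End Majorants.

(** * Convergence of sums of powers, units and division *)

Section GeometricSums.
Variables (R : realType) (n : nat).
Local Notation C := R[i].
Local Notation fps := (fps R n).
Local Notation conv := (@convergent R n).
Implicit Types (f g h : fps) (a b : mindex n).
Local Notation nc := (@Normc.normc R).

Lemma coefM_low f g g' a :
  (forall b, (mdeg b <= mdeg a)%N -> g b = g' b) -> (f * g) a = (f * g') a.
Proof.
move=> h; rewrite !(fpsME _ _ (@leq_mdeg n a)); apply: eq_boxsum => b hb; congr (_ * _).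
by apply: h; have := mdeg_sub hb; lia.
Qed.

Lemma exp_low u p h a : ev0 u = 0 -> (mdeg a < p)%N -> (u ^+ p * h) a = 0.
Proof.
move=> u0; elim: p h a => // p IH h a ha; rewrite exprS -mulrA.
rewrite (fpsME _ _ (@leq_mdeg n a)) /boxsum big1 // => b /forallP hb.
have [e|e] := eqVneq (boxval b) (mzero n); first by rewrite e (u0 : u _ = 0) mul0r.
rewrite IH ?mulr0 //; have := mdeg_sub hb; move: e; rewrite -mdeg_eq0; lia.
Qed.

(** As $u^p$ starts in degree at least $p$, each coefficient of $\sum_p u^p H_p$ is a finite sum.
    Convergence holds because a larger radius parameter makes the majorant of [u] as small as
    desired, beating the growth $K^p$ of [H p]. *)
Lemma geometric_sum (u : fps) (H : nat -> fps) (K D : R) :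
  conv u -> ev0 u = 0 -> 1 <= K -> 1 <= D ->
  (forall p a, nc (H p a) <= D * K ^+ (mdeg a + p)) ->
  exists2 Q : fps, conv Q &
    forall N a, (mdeg a < N)%N -> Q a = (\sum_(p < N) u ^+ p * H p) a.
Proof.
move=> cu u0 K1 D1 hH.
pose Q : fps := fun a => (\sum_(p < (mdeg a).+1) u ^+ p * H p) a.
have QE N a : (mdeg a < N)%N -> Q a = (\sum_(p < N) u ^+ p * H p) a.
  move=> aN; rewrite /Q !fps_sumE.
  rewrite (big_ord_widen N (fun p => (u ^+ p * H p) a)) // [RHS](bigID (fun p : 'I_N => (p < (mdeg a).+1)%N)) /=.
  by rewrite [X in _ + X]big1 ?addr0 // => p; rewrite -leqNgt => hp; apply: exp_low.
exists Q => //.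
have [K' [M [K1' M1 hu]]] := convergent_maj cu.
(* [e] is chosen with $e K 2^n = 1$, to cancel $K^p$ from [H p] and $2^{np}$ from the weight of
   $u^p$. [L] is large enough that [u], having no constant term, is majorized with constant [e]
   instead of [M]. *)
pose e := (K * 2 ^+ n)^-1; pose L := K + K' * (1 + M / e).
have p2 : 1 <= 2 ^+ n :> R by apply: exprn_ege1; lra.
have K0 : 0 < K by lra.
have e0 : 0 < e by rewrite invr_gt0 mulr_gt0 // exprn_gt0.
have Me : 0 < M / e by rewrite divr_gt0 //; lra.
have L1 : 1 <= L by rewrite /L; nra.
have KL : K <= L by rewrite /L; nra.
have L0 : 0 <= L by lra.
have hu' : maj 0 L e u.
  move=> a; rewrite bw0 mulr1; have [->|] := eqVneq a (mzero n).
    by rewrite (u0 : u _ = 0) Normc.normc0; apply: mulr_ge0; [exact: ltW | exact: exprn_ge0].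
  rewrite -mdeg_eq0; case E : (mdeg a) => [//|d] _.
  have := hu a; rewrite bw0 mulr1 E => /le_trans; apply.
  apply: le_trans (_ : _ <= e * (K' * (1 + M / e)) ^+ d.+1) _.
    have hM : M <= e * (1 + M / e) ^+ d.+1.
      rewrite -ler_pdivrMl // [_ * M]mulrC; apply: le_trans (_ : _ <= 1 + M / e) _; first by lra.
      by rewrite exprS ler_peMr ?exprn_ege1 //; lra.
    rewrite exprMn mulrCA [leLHS]mulrC; apply: ler_wpM2l => //.
    by apply: exprn_ge0; lra.
  apply: ler_wpM2l; first exact: ltW.
  by apply: lerXn2r; rewrite ?nnegrE; rewrite /L; nra.
have hup p q h E : 0 <= E -> maj q L E h -> maj (q + p) L (e ^+ p * E) (u ^+ p * h).
  move=> E0 hh; elim: p => [|p IH]; first by rewrite addn0 !expr0 !mul1r.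
  rewrite addnS !exprS -!mulrA [e * _]mulrC [u * _]mulrC; apply: majM => //.
    by rewrite mulr_ge0 // exprn_ge0 // ltW.
  exact: ltW.
apply: (@maj_convergent _ _ 0 (4 * L) D); first by lra.
move=> a; rewrite bw0 mulr1 /Q fps_sumE; apply: le_trans (nc_sum _ _ _) _.
apply: le_trans (_ : _ <= \sum_(p < (mdeg a).+1) D * (2 * L) ^+ mdeg a) _.
  apply: ler_sum => p _.
  have hHp : maj 0 L (D * K ^+ p) (H p).
    move=> b; rewrite bw0 mulr1; apply: le_trans (hH p b) _.
    rewrite addnC exprD mulrA; apply: ler_wpM2l; first by rewrite mulr_ge0 ?exprn_ge0 //; lra.
    by apply: lerXn2r; rewrite ?nnegrE //; lra.
  have DK0 : 0 <= D * K ^+ p by rewrite mulr_ge0 ?exprn_ge0 //; lra.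
  apply: le_trans (hup p 0%N (H p) _ DK0 hHp a) _.
  have c0 : 0 <= e ^+ p * (D * K ^+ p) * L ^+ mdeg a.
    by rewrite !mulr_ge0 ?exprn_ge0 //; lra.
  apply: le_trans (_ : _ <= e ^+ p * (D * K ^+ p) * L ^+ mdeg a * (2 ^ (mdeg a + n * p))%:R) _.
    by apply: ler_wpM2l => //; rewrite ler_nat add0n bw_leq.
  have e1 : (e * K * 2 ^+ n) ^+ p = 1.
    by rewrite -mulrA mulVf ?expr1n // gt_eqF // mulr_gt0 // exprn_gt0.
  rewrite natrX exprD exprM le_eqVlt; apply/orP; left; apply/eqP.
  transitivity ((e * K * 2 ^+ n) ^+ p * (D * (2 * L) ^+ mdeg a)); last by rewrite e1 mul1r.
  by rewrite !exprMn; ring.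
(* The number $|a|+1$ of terms is at most $2^{|a|}$, which turns $2L$ into $4L$. *)
rewrite sumr_const card_ord -[leLHS]mulr_natl mulrCA; apply: ler_wpM2l; first by lra.
rewrite (_ : 4 * L = 2 * (2 * L)); last by ring.
rewrite [leRHS]exprMn; apply: ler_wpM2r; first by rewrite exprn_ge0 //; lra.
by rewrite -natrX ler_nat ltn_expl.
Qed.

(** Neumann series: $f = f(0)(1-u)$ with $u(0)=0$, so the inverse is $f(0)^{-1}\sum_p u^p$. *)
Lemma conv_inv f : conv f -> ev0 f != 0 -> exists2 g : fps, conv g & f * g = 1.
Proof.
move=> cf f0; pose u : fps := 1 - polC (ev0 f)^-1 * f.
have cu : conv u by apply: convB; [exact: conv1 | apply: convM => //; exact: conv_polC].
have u0 : ev0 u = 0 by rewrite rmorphB rmorphM rmorph1 /= ev0_polC mulVf // subrr.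
have [|Q cQ QE] := @geometric_sum u (fun=> 1) 1 1 cu u0 (lexx _) (lexx _).
  move=> p a; rewrite mul1r expr1n -polC1 /polC.
  by case: ifP => _; rewrite ?Normc.normc1 ?Normc.normc0.
exists (polC (ev0 f)^-1 * Q); first by apply: convM => //; apply: conv_polC.
rewrite mulrA [f * _]mulrC; have -> : polC (ev0 f)^-1 * f = 1 - u by rewrite /u; ring.
apply: funext => a; rewrite (@coefM_low _ _ (\sum_(p < (mdeg a).+1) u ^+ p * 1)); last first.
  by move=> b hb; apply: QE.
under eq_bigr do rewrite mulr1.
have -> : (1 - u) * (\sum_(p < (mdeg a).+1) u ^+ p) = 1 - u ^+ (mdeg a).+1 * 1.
  rewrite mulr1 -[in RHS](expr1n _ (mdeg a).+1) subrXX; congr (_ * _).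
  by apply: eq_bigr => i _; rewrite expr1n mul1r.
by rewrite fpsDE fpsNE exp_low // subr0.
Qed.

Definition shift (j : 'I_n) f : fps := fun a => f (madd a (munit j)).
Definition trunc (j : 'I_n) f : fps := fun a => if a j == 0%N then f a else 0.

Lemma trunc_shift j f : f = trunc j f + Xvar R j * shift j f.
Proof.
apply: funext => a; rewrite fpsDE /trunc; case: ifP => [/eqP aj|].
  by rewrite XvarM_zero // addr0.
move/negbT; rewrite -lt0n => aj; rewrite add0r -(madd_subK aj) XvarM_pos /shift.
by rewrite madd_subK.
Qed.

Lemma pd_shift l j f : l != j -> pd l f = 0 -> pd l (shift j f) = 0.
Proof.
move=> lj /(congr1 (shift j)) h; rewrite -[RHS]h; apply: funext => a.
rewrite /shift !pdE !mE (negPf lj) addn0 /shift; congr (_ * f _).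
by apply: mindexP => i; rewrite !mE addnAC.
Qed.

Lemma pd_trunc l j f : l != j -> pd l f = 0 -> pd l (trunc j f) = 0.
Proof.
move=> lj h; apply: funext => a; rewrite pdE /trunc !mE [j == l]eq_sym (negPf lj) addn0.
case: ifP => _; last by rewrite mulr0.
by rewrite -pdE h.
Qed.

Lemma pd_trunc_diag j f : pd j (trunc j f) = 0.
Proof. by apply: funext => a; rewrite pdE /trunc !mE eqxx addn1 /= mulr0. Qed.

Lemma pdX j f p : pd j f = 0 -> pd j (f ^+ p) = 0.
Proof.
by move=> h; elim: p => [|p IH]; rewrite ?expr0 ?pd1 // exprS pdM h IH mul0r mulr0 addr0.
Qed.

Lemma shift_iterE j f p a : iter p (shift j) f a = f (madd a [ffun i => ((i == j) * p)%N]).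
Proof.
elim: p a => [|p IH] a /=.
  by congr f; apply: mindexP => i; rewrite !mE ffunE muln0 addn0.
by rewrite [LHS]IH; congr f; apply: mindexP => i; rewrite !mE !ffunE mulnS addnA.
Qed.

Lemma mdeg_shift j p : mdeg ([ffun i => ((i == j) * p)%N] : mindex n) = p.
Proof.
rewrite /mdeg (bigD1 j) //= ffunE eqxx mul1n big1 ?addn0 // => i /negPf ij.
by rewrite ffunE ij mul0n.
Qed.

(* With [F = trunc F + X_j * shift F], the quotient of [F] by [X_j - g] is
   [sum_p g^p * shift^(p+1) F] and the remainder is [sum_p g^p * trunc (shift^p F)]. *)
Lemma graph_division j (g F : fps) : conv g -> ev0 g = 0 -> pd j g = 0 -> conv F ->
  exists Q Rm : fps, [/\ conv Q, conv Rm, F = (Xvar R j - g) * Q + Rm,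
    pd j Rm = 0 & forall l, l != j -> pd l g = 0 -> pd l F = 0 -> pd l Rm = 0].
Proof.
move=> cg g0 gj cF; have [K [D [K1 D1 hF]]] := convergent_maj cF.
pose T p := iter p (shift j) F.
have hT p a : nc (T p a) <= D * K ^+ (mdeg a + p).
  by rewrite /T shift_iterE; have := hF (madd a [ffun i => ((i == j) * p)%N]);
     rewrite mdegD mdeg_shift bw0 mulr1.
have KD1 : 1 <= K * D by nra.
have [||p a|Q cQ QE] := @geometric_sum g (fun p => T p.+1) K (K * D) cg g0 => //.
  by apply: le_trans (hT _ _) _; rewrite addnS exprS le_eqVlt; apply/orP; left; apply/eqP; ring.
have [||p a|Rm cRm RmE] := @geometric_sum g (fun p => trunc j (T p)) K D cg g0 => //.
  rewrite /trunc; case: ifP => _ //; rewrite Normc.normc0.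
  by rewrite mulr_ge0 ?exprn_ge0 //; lra.
have pdRm l : pd l g = 0 -> (forall p, pd l (trunc j (T p)) = 0) -> pd l Rm = 0.
  move=> gl hl; apply: funext => a; rewrite pdE (RmE (mdeg (madd a (munit l))).+1) // -pdE.
  rewrite raddf_sum big1 // => p _.
  by rewrite /= pdM pdX // hl mul0r mulr0 addr0.
exists Q, Rm; split=> //; last 2 first.
- by apply: pdRm => // p; apply: pd_trunc_diag.
- move=> l lj gl Fl; apply: pdRm => // p; apply: pd_trunc => //.
  by elim: p => // p IH; apply: pd_shift.
(* Telescoping of the finite sums. The error $g^N T_N$ has order at least [N], so it is invisible at
   exponent [a] once $N = |a|+1$. *)
have fin N : F = (Xvar R j - g) * (\sum_(p < N) g ^+ p * T p.+1) +
    \sum_(p < N) g ^+ p * trunc j (T p) + g ^+ N * T N.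
  elim: N => [|N IH]; first by rewrite !big_ord0 mulr0 !add0r mul1r.
  have e : T N = trunc j (T N) + Xvar R j * shift j (T N) := trunc_shift j (T N).
  by rewrite {1}IH !big_ord_recr /= {1}e exprS; ring.
apply: funext => a; rewrite {1}(fin (mdeg a).+1) fpsDE exp_low // addr0 !fpsDE.
congr (_ + _); last by rewrite -RmE.
by apply: coefM_low => b hb; rewrite -QE.
Qed.

End GeometricSums.

(** * Vector fields and balanced subalgebras *)

Section Derivations.
Variables (R : realType) (n : nat).
Local Notation C := R[i].
Local Notation fps := (fps R n).
Local Notation conv := (@convergent R n).
Local Notation vf := (vfield R n).
Implicit Types (f g h : fps) (D E : vf).

Definition act D f : fps := \sum_(i < n) (D i : fps) * pd i f.

Lemma vactE D f : vact D f = act D f.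
Proof. by apply: funext => a; rewrite /act fps_sumE. Qed.

Let act_sub D : zmod_morphism (act D).
Proof.
move=> f g; rewrite /act -sumrB; apply: eq_bigr => i _.
by rewrite raddfB mulrBr.
Qed.
HB.instance Definition _ D := GRing.isZmodMorphism.Build fps fps (act D) (act_sub D).

Lemma actB D f g : act D (f - g) = act D f - act D g. Proof. exact: raddfB. Qed.

Lemma act_sum D I (r : seq I) (P : pred I) (F : I -> fps) :
  act D (\sum_(i <- r | P i) F i) = \sum_(i <- r | P i) act D (F i).
Proof. exact: raddf_sum. Qed.

Lemma actM D f g : act D (f * g) = act D f * g + f * act D g.
Proof.
rewrite /act mulr_suml mulr_sumr -big_split /=; apply: eq_bigr => i _.
by rewrite pdM; ring.
Qed.

Lemma act_polC D c : act D (polC c) = 0.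
Proof. by rewrite /act big1 // => i _; rewrite pd_polC mulr0. Qed.

Lemma act_Xvar D j : act D (Xvar R j) = D j.
Proof.
rewrite /act (bigD1 j) //= big1 ?addr0 => [|i /negPf ij]; rewrite pd_Xvar.
  by rewrite eqxx mulr1.
by rewrite ij mulr0.
Qed.

Lemma ev0_act D f : ev0 (act D f) = \sum_(i < n) ev0 (D i) * ev0 (pd i f).
Proof. by rewrite rmorph_sum; apply: eq_bigr => i _; rewrite rmorphM. Qed.

Lemma conv_act D f : in_Der D -> conv f -> conv (act D f).
Proof. by move=> hD hf; apply: conv_sum => i _; apply: convM => //; apply: conv_pd. Qed.

Definition vmul (p : fps) D : vf := fun i => p * D i.

Lemma vmulE p D i : vmul p D i = p * (D i : fps).
Proof. by []. Qed.

Lemma vaddE D E i : vadd D E i = (D i : fps) + (E i : fps) :> fps.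
Proof. by []. Qed.

Lemma act_vmul p D f : act (vmul p D) f = p * act D f.
Proof. by rewrite /act mulr_sumr; apply: eq_bigr => i _; rewrite mulrA. Qed.

Lemma act_vadd D E f : act (vadd D E) f = act D f + act E f.
Proof. by rewrite /act -big_split; apply: eq_bigr => i _; exact: (mulrDl (D i : fps) (E i : fps)). Qed.

Lemma vscaleE c D : vscale c D = vmul (polC c) D.
Proof. by apply: funext => i; apply: sscaleE. Qed.

Lemma act_vzero f : act (vzero R (n:=n)) f = 0.
Proof. by rewrite /act big1 // => i _; apply: mul0r. Qed.

Lemma vbracketE D E j : vbracket D E j = act D (E j) - act E (D j) :> fps.
Proof. by rewrite /vbracket !vactE. Qed.

Lemma act_bracket D E f : act (vbracket D E) f = act D (act E f) - act E (act D f).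
Proof.
(* The second-order part is symmetric in the two fields, since partial derivatives commute, and
   cancels in the commutator. *)
have e D' E' : act D' (act E' f) =
    \sum_i act D' (E' i) * pd i f + \sum_i \sum_j (E' i : fps) * D' j * pd j (pd i f).
  rewrite {2}/act raddf_sum -big_split; apply: eq_bigr => i _ /=.
  rewrite actM; congr (_ + _); rewrite /act mulr_sumr; apply: eq_bigr => j _.
  by rewrite mulrA.
rewrite !e [X in _ - (_ + X)]exchange_big /=.
under [X in _ - (_ + X)]eq_bigr => i _ do under eq_bigr => j _ do
  rewrite [_ * _ * pd i _]mulrC pdC [_ * (_ * _)]mulrC [(D j : fps) * _]mulrC.
rewrite opprD addrACA subrr addr0 -sumrB; apply: eq_bigr => i _.
by rewrite -mulrBl -vbracketE.
Qed.

Lemma in_Der_vmul p D : conv p -> in_Der D -> in_Der (vmul p D).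
Proof. by move=> hp hD i; apply: convM. Qed.

Lemma in_Der_vadd D E : in_Der D -> in_Der E -> in_Der (vadd D E).
Proof. by move=> hD hE i; apply: convD. Qed.

Lemma in_Der_vscale c D : in_Der D -> in_Der (vscale c D).
Proof. by move=> hD; rewrite vscaleE; apply: in_Der_vmul => //; apply: conv_polC. Qed.

Lemma in_Der_vzero : in_Der (vzero R (n:=n)).
Proof. by move=> i; apply: conv0. Qed.

Lemma in_Der_bracket D E : in_Der D -> in_Der E -> in_Der (vbracket D E).
Proof. by move=> hD hE i; rewrite vbracketE; apply: convB; apply: conv_act. Qed.

Lemma vfieldP D E : (forall i, D i = E i :> fps) -> D = E.
Proof. by move=> h; apply: funext. Qed.

Lemma veqP D E : veq D E <-> D = E.
Proof. by split=> [h|-> //]; apply: funext => i; apply: funext => a. Qed.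

Lemma subspaceB (A : vf -> Prop) D E : subspace A -> A D -> A E ->
  A (vadd D (vscale (-1) E)).
Proof. by case=> _ [_ [hadd hsc]] hD hE; apply: hadd => //; apply: hsc. Qed.

Lemma vsubE D E i : vadd D (vscale (-1) E) i = (D i : fps) - (E i : fps).
Proof.
rewrite vscaleE; transitivity ((D i : fps) + polC (-1) * (E i : fps)) => //.
have -> // : polC (-1) * (E i : fps) = - (E i : fps).
by apply: funext => a; rewrite polCM mulN1r.
Qed.

Lemma mulrn_fps_eq0 k f : (0 < k)%N -> k%:R * f = 0 -> f = 0.
Proof.
move=> k0 h; apply: funext => a; have := congr1 (fun g : fps => g a) h.
rewrite -polC_nat polCM => /eqP; rewrite mulf_eq0 pnatr_eq0.
by case: k k0 {h} => //= k _ /eqP.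
Qed.

Lemma pd_exp j f k : pd j (f ^+ k.+1) = k.+1%:R * f ^+ k * pd j f.
Proof.
elim: k => [|k IH]; first by rewrite expr1 expr0 !mul1r.
by rewrite exprS pdM IH [f ^+ k.+1 in RHS]exprS -[k.+2]addn1 natrD exprS; ring.
Qed.

(** With $d = \partial_j f$, differentiating $f^{i+1}d^m = 0$ and multiplying by $d$ gives $(i+1)f^i
    d^{m+2} = 0$: one factor $f$ is traded for two factors $d$, until no $f$ is left. *)
Lemma nilpotent_pd j f k : f ^+ k = 0 -> exists m, pd j f ^+ m = 0.
Proof.
move=> fk; set d := pd j f.
suff H i m : f ^+ i * d ^+ m = 0 -> exists l, d ^+ l = 0 by apply: (H k 0%N); rewrite fk mul0r.
elim: i m => [|i IH] m h; first by exists m; rewrite -h mul1r.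
apply: (IH m.+2); apply: (@mulrn_fps_eq0 i.+1) => //.
have := congr1 (fun g => pd j g * d) h; rewrite raddf0 mul0r pdM pd_exp -/d.
case: m h => [|m] h; first by rewrite expr0 pd1 mulr0 addr0 => <-; rewrite !exprS expr0; ring.
move=> e; have : f ^+ i.+1 * d ^+ m.+1 * (m.+1%:R * pd j d) = 0 by rewrite h mul0r.
move: e; rewrite pd_exp => e1 e2; rewrite -[RHS]e1 -[LHS]addr0 -e2 !exprS; ring.
Qed.

(** Induction on the degree of the coefficient: the value at 0 is a nilpotent number, and a
    coefficient of positive degree is, up to a nonzero integer, one of lower degree in a partial
    derivative, again nilpotent. *)
Lemma nilpotent_eq0 f k : f ^+ k = 0 -> f = 0.
Proof.
move=> fk; apply: funext => a; move Ed : (mdeg a) => d.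
elim: d a f k fk Ed => [|d IH] a f k fk Ed.
  have /eqP -> : a == mzero n by rewrite -mdeg_eq0 Ed.
  have := congr1 (@ev0 R n) fk; rewrite rmorphXn raddf0 /= => /eqP.
  by rewrite expf_eq0 => /andP[_ /eqP].
have [|j aj] := @mdeg_gt0 n a; first by rewrite Ed.
have [m dm] := nilpotent_pd j fk.
have := IH (msub a (munit j)) _ _ dm; rewrite pdE madd_subK // fps0E => h.
have /h/eqP : mdeg (msub a (munit j)) = d.
  by have := mdegD (msub a (munit j)) (munit j); rewrite madd_subK // Ed mdeg_unit; lia.
by rewrite mulf_eq0 pnatr_eq0 /= => /eqP.
Qed.

Lemma sqr_neq0 f : f != 0 -> f ^+ 2 != 0.
Proof. by apply: contraNneq => /nilpotent_eq0 ->. Qed.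

(* If [a^2 = 0] as a derivation then [0 = a^2(f^2) = 2 a(f)^2] for all [f]. *)
Lemma act_twice_neq0 a : in_Der a -> ~ veq a (vzero R (n:=n)) ->
  exists2 f, conv f & act a (act a f) != 0.
Proof.
move=> ca a0; apply: contrapT => nh.
have a2 f : conv f -> act a (act a f) = 0.
  by move=> cf; apply/eqP; apply/negPn/negP => h; apply: nh; exists f.
apply: a0; apply/veqP; apply: vfieldP => i; apply: (@nilpotent_eq0 _ 2).
apply: (@mulrn_fps_eq0 2) => //.
have := a2 _ (convM (conv_Xvar R i) (conv_Xvar R i)).
rewrite !actM raddfD /= !actM !act_Xvar.
have := a2 _ (conv_Xvar R i); rewrite act_Xvar => -> <-; rewrite expr2; ring.
Qed.

End Derivations.

(** * Balanced subalgebras and their orbit ideals *)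

Section Balanced.
Variables (R : realType) (n : nat).
Local Notation C := R[i].
Local Notation fps := (fps R n).
Local Notation conv := (@convergent R n).
Local Notation vf := (vfield R n).
Implicit Types (f g h p : fps) (D E c : vf) (A B : vf -> Prop) (I : fps -> Prop).

Lemma balanced_conductor A : balanced A ->
  exists p, [/\ conv p, p != 0 & forall h c, conv h -> in_Der c -> A (vmul (p * h) c)].
Proof.
move=> [[subA brA] [_ [a [Aa [a0 [h1 h2]]]]]].
have [dA [_ [addA scA]]] := subA; have ca := dA _ Aa.
have [f cf q0] := act_twice_neq0 ca a0; set q := act a (act a f) in q0.
have cq : conv q by apply: conv_act => //; apply: conv_act.
(* This is $[a, a(f)c] - [[a, fa], c]$: as $[a,fa] = a(f)a$, the two terms $a(f)[a,c]$ cancel. *)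
pose w c : vf := vadd (vmul q c) (vmul (act c (act a f)) a).
have Aw c : in_Der c -> A (w c).
  move=> cc; rewrite (_ : w c = vadd (vbracket a (vmul (act a f) c))
      (vscale (-1) (vbracket (vbracket a (vmul f a)) c))).
    apply: subspaceB => //; last by apply: h2 => //; apply: in_Der_vmul.
    by apply: h1; apply: in_Der_vmul => //; apply: conv_act.
  have -> : vbracket a (vmul f a) = vmul (act a f) a.
    by apply: vfieldP => j; rewrite vbracketE !vmulE act_vmul actM; ring.
  apply: vfieldP => i.
  by rewrite vsubE !vbracketE /w vaddE !vmulE !act_vmul !actM -/q; ring.
(* For $c = ha$ both summands of [w c] equal $qha$, hence the factor $1/2$. *)
have Aqa h : conv h -> A (vmul (q * h) a).
  move=> ch; have := scA 2^-1 _ (Aw (vmul h a) (in_Der_vmul ch ca)).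
  congr A; apply: vfieldP => i; rewrite vscaleE [LHS]vmulE /w vaddE !vmulE act_vmul -/q.
  have e : polC 2^-1 * 2%:R = 1 :> fps by rewrite -polC_nat -polC_mul mulVf ?pnatr_eq0.
  by rewrite -[RHS]mul1r -e; ring.
exists (q ^+ 2); split; [exact: convX | exact: sqr_neq0 |] => h c ch cc.
have chc : in_Der (vmul h c) by apply: in_Der_vmul.
have cqhc : in_Der (vmul q (vmul h c)) by apply: in_Der_vmul.
(* Inserting $qhc$ in [w] makes its second summand a multiple of $qa$, which [Aqa] removes. *)
have -> : vmul (q ^+ 2 * h) c = vadd (w (vmul q (vmul h c)))
    (vscale (-1) (vmul (q * act (vmul h c) (act a f)) a)).
  apply: vfieldP => i; rewrite vsubE /w vaddE !vmulE act_vmul expr2; ring.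
by apply: subspaceB; [exact: subA | exact: Aw | apply: Aqa; apply: conv_act => //; exact: conv_act].
Qed.

Definition ideal I := [/\ forall f, I f -> conv f, I 0,
  forall f g, I f -> I g -> I (f + g) & forall h f, conv h -> I f -> I (h * f)].

Lemma idealB I f g : ideal I -> I f -> I g -> I (f - g).
Proof.
move=> [_ _ hD hM] hf hg; apply: hD => //.
by rewrite -mulN1r; apply: hM => //; apply: convN; apply: conv1.
Qed.

Lemma ideal_sum I (T : Type) (r : seq T) (P : pred T) (F : T -> fps) : ideal I ->
  (forall i, P i -> I (F i)) -> I (\sum_(i <- r | P i) F i).
Proof. by move=> [_ I0 hD _] h; elim/big_ind: _. Qed.

Lemma tangent_algebraE I D : tangent_algebra I D <-> in_Der D /\ forall g, I g -> I (act D g).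
Proof. by split=> -[h1 h2]; split=> // g /h2; rewrite vactE. Qed.

Lemma tangent_vmul I p D : ideal I -> conv p -> tangent_algebra I D -> tangent_algebra I (vmul p D).
Proof.
move=> [_ _ _ hM] cp /tangent_algebraE[cD hD]; apply/tangent_algebraE; split.
  exact: in_Der_vmul.
by move=> g /hD Ig; rewrite act_vmul; apply: hM.
Qed.

Lemma tangent_lie I : ideal I -> lie_subalgebra (tangent_algebra I).
Proof.
move=> hI; have [_ I0 hD hM] := hI; split; first split.
- by move=> D [].
- split; first by apply/tangent_algebraE; split=> [|g _]; rewrite ?act_vzero //; apply: in_Der_vzero.
  split=> [D E|c D].
    move=> /tangent_algebraE[cD iD] /tangent_algebraE[cE iE]; apply/tangent_algebraE.
    by split=> [|g Ig]; [exact: in_Der_vadd | rewrite act_vadd; apply: hD; auto].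
  by rewrite vscaleE; apply: tangent_vmul => //; apply: conv_polC.
- move=> D E /tangent_algebraE[cD iD] /tangent_algebraE[cE iE]; apply/tangent_algebraE.
  split=> [|g Ig]; first exact: in_Der_bracket.
  by rewrite act_bracket; apply: idealB; auto.
Qed.

Definition words_in A (l : seq vf) := foldr (fun D P => A D /\ P) True l.

Lemma words_in_cat A l m : words_in A (l ++ m) <-> words_in A l /\ words_in A m.
Proof. by elim: l => [|D l IH] /=; tauto. Qed.

(* The ideal of the orbit of [0] under [A]: the largest [A]-stable ideal vanishing at [0]. *)
Definition orbit_ideal A f := conv f /\ forall l, words_in A l -> ev0 (foldr (@act R n) f l) = 0.

Lemma orbit_idealW A B f : (forall D, A D -> B D) -> orbit_ideal B f -> orbit_ideal A f.
Proof.
move=> AB [cf h]; split=> // l hl; apply: h.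
by elim: l hl => //= D l IH [/AB hD /IH].
Qed.

Lemma orbit_ideal_act A D f : (forall E, A E -> in_Der E) -> A D ->
  orbit_ideal A f -> orbit_ideal A (act D f).
Proof.
move=> dA AD [cf h]; split=> [|l hl]; first by apply: conv_act => //; apply: dA.
by rewrite -[act D f]/(foldr (@act R n) f [:: D]) -foldr_cat; apply: h; apply/words_in_cat.
Qed.

Lemma foldr_act_sub l f g : foldr (@act R n) (f - g) l = foldr (@act R n) f l - foldr (@act R n) g l.
Proof. by elim: l => //= D l ->; rewrite raddfB. Qed.

Lemma foldr_act_add l f g : foldr (@act R n) (f + g) l = foldr (@act R n) f l + foldr (@act R n) g l.
Proof. by elim: l => //= D l ->; rewrite raddfD. Qed.

Lemma foldr_act0 l : foldr (@act R n) 0 l = 0.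
Proof. by elim: l => //= D l ->; rewrite raddf0. Qed.

Lemma orbit_ideal_ideal A : (forall E, A E -> in_Der E) -> ideal (orbit_ideal A).
Proof.
move=> dA; split.
- by move=> f [].
- by split=> [|l _]; [exact: conv0 | rewrite foldr_act0 raddf0].
- move=> f g [cf hf] [cg hg]; split=> [|l hl]; first exact: convD.
  by rewrite foldr_act_add raddfD /= hf // hg // addr0.
- move=> h f ch hf; split=> [|l]; first by apply: convM => //; case: hf.
  (* The last letter acts first. By the Leibniz rule it turns $hf$ into $D(h)f + hD(f)$, and both
     terms are again a germ times an element of the orbit ideal. *)
  elim/last_ind: l h f ch hf => [|l D IH] h f ch hf.
    by move=> _ /=; rewrite rmorphM; case: hf => _ /(_ [::] I) /= ->; rewrite mulr0.
  rewrite -cats1 => /words_in_cat[hl [AD _]]; rewrite foldr_cat /= actM foldr_act_add raddfD /=.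
  rewrite !IH ?addr0 //; [exact: orbit_ideal_act | apply: conv_act => //; exact: dA].
Qed.

Lemma orbit_ideal_max A I f : (forall g, I g -> conv g /\ ev0 g = 0) ->
  (forall D g, A D -> I g -> I (act D g)) -> I f -> orbit_ideal A f.
Proof.
move=> I0 IA If; split=> [|l hl]; first by case: (I0 _ If).
suff : I (foldr (@act R n) f l) by move=> /I0[].
by elim: l hl => //= D l IH [AD /IH]; apply: IA.
Qed.

Lemma tangent_orbit A D : (forall E, A E -> in_Der E) -> A D -> tangent_algebra (orbit_ideal A) D.
Proof.
move=> dA AD; apply/tangent_algebraE; split; first exact: dA.
by move=> g; apply: orbit_ideal_act.
Qed.

Lemma balanced_orbit_ideal_neq0 A : balanced A -> exists2 f, orbit_ideal A f & f != 0.
Proof.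
move=> bA; have [p [cp p0 hp]] := balanced_conductor bA.
have [[subA brA] [idA [a [Aa [a0 _]]]]] := bA; have [dA _] := subA.
(* [I] is [A]-stable because $D(g)c = [D, gc] - g[D,c]$. *)
pose I f := conv f /\ forall c, in_Der c -> A (vmul f c).
exists p => //; apply: (@orbit_ideal_max _ I); last first.
- by split=> // c cc; rewrite -[p]mulr1; apply: hp => //; apply: conv1.
- move=> D g AD [cg hg]; have cD := dA _ AD; split=> [|c cc]; first exact: conv_act.
  have -> : vmul (act D g) c = vadd (vbracket D (vmul g c)) (vscale (-1) (vmul g (vbracket D c))).
    apply: vfieldP => i; rewrite vsubE !vmulE !vbracketE vmulE actM act_vmul; ring.
  apply: subspaceB => //; first by apply: brA => //; apply: hg.
  by apply: hg; apply: in_Der_bracket.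
(* A germ of [I] not vanishing at 0 would be a unit and force all fields into [A]; but the algebra
   of all fields is an ideal of itself, and nonzero. *)
- move=> g [cg hg]; split=> //; apply/eqP; apply: contrapT => /negP g0.
  have [h ch gh] := conv_inv cg g0.
  have all c : in_Der c -> A c.
    move=> cc; have -> : c = vmul g (vmul h c) by apply: vfieldP => i; rewrite !vmulE mulrA gh mul1r.
    by apply: hg; apply: in_Der_vmul.
  apply: a0; apply: (idA (@in_Der R n)) => //; last exact: dA.
  split; last exact: in_Der_bracket.
  split=> //; split; first exact: in_Der_vzero.
  split; [exact: in_Der_vadd | exact: in_Der_vscale].
Qed.

End Balanced.

(** * The orbit of the origin *)

Section Factorials.
Variable n : nat.
Implicit Types a b : mindex n.

Definition mfact a : nat := (\prod_(i < n) (a i)`!)%N.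

Lemma mfact_gt0 a : (0 < mfact a)%N.
Proof. by apply: prodn_gt0 => i; apply: fact_gt0. Qed.

Lemma mfact_unit a i : mfact (madd a (munit i)) = ((a i).+1 * mfact a)%N.
Proof.
rewrite /mfact (bigD1 i) // [in RHS](bigD1 i) //= !mE eqxx addn1 factS mulnA; congr (_ * _)%N.
by apply: eq_bigr => j /negPf ji; rewrite !mE ji addn0.
Qed.

(** Multinomial bound $|a|!/a! \le n^{|a|}$: some $a_i$ is at least the average $|a|/n$, and
    lowering it by one gives the induction. It makes the factorial growth of iterated derivations
    geometric after division by $a!$. *)
Lemma fact_leq_mfact a : ((mdeg a)`! <= n ^ mdeg a * mfact a)%N.
Proof.
move Em : (mdeg a) => m; elim: m a Em => [|m IH] a Em; first by rewrite mul1n mfact_gt0.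
have /existsP[i hi] : [exists i, (m.+1 <= n * a i)%N].
  apply: contraT; rewrite negb_exists => /forallP h.
  have n0 : (0 < n)%N.
    by case: (posnP n) => // n0; move: Em; rewrite /mdeg big1 // => i; have := ltn_ord i; lia.
  have : (\sum_(i < n) n * a i <= \sum_(i < n) m)%N.
    by apply: leq_sum => i _; rewrite -ltnS ltnNge h.
  by rewrite -big_distrr /= -/(mdeg a) Em sum_nat_const card_ord leq_pmul2l // ltnn.
have ai : (0 < a i)%N by case: (posnP (a i)) hi => // ->; rewrite muln0.
have {}IH := IH (msub a (munit i)).
have Ed : mdeg (msub a (munit i)) = m.
  by have := mdegD (msub a (munit i)) (munit i); rewrite madd_subK // Em mdeg_unit; lia.
rewrite -[in mfact a](madd_subK ai) mfact_unit factS expnS !mE eqxx subn1 prednK //.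
rewrite mulnACA; exact: leq_mul hi (IH Ed).
Qed.

(** The normally ordered word $1^{a_1}\cdots n^{a_n}$, chosen as representative of all words with
    the same letter counts. *)
Definition word a : seq 'I_n := flatten [seq nseq (a i) i | i <- enum 'I_n].

Lemma count_word a i : count_mem i (word a) = a i.
Proof.
rewrite /word count_flatten -map_comp sumnE big_map big_enum /= (bigD1 i) //=.
rewrite count_nseq /= eqxx mul1n big1 ?addn0 // => j /negPf ji.
by rewrite count_nseq /= ji.
Qed.

Lemma size_word a : size (word a) = mdeg a.
Proof.
rewrite /word size_flatten /shape -map_comp sumnE big_map big_enum /=.
by apply: eq_bigr => i _; rewrite size_nseq.
Qed.

Definition tally (s : seq 'I_n) : mindex n := [ffun i => count_mem i s].

Lemma perm_word s : perm_eq (word (tally s)) s.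
Proof. by apply/allP => i _ /=; rewrite count_word ffunE. Qed.

Lemma tally_word a : tally (word a) = a.
Proof. by apply: mindexP => i; rewrite ffunE count_word. Qed.

End Factorials.

Section OrbitIdeal.
Variables (R : realType) (n : nat).
Local Notation C := R[i].
Local Notation fps := (fps R n).
Local Notation conv := (@convergent R n).
Local Notation vf := (vfield R n).
Implicit Types (f g h F : fps) (D E c : vf) (A B : vf -> Prop) (I : fps -> Prop).
Implicit Types (S : {set 'I_n}) (X : 'I_n -> vf) (a b : mindex n).
Local Notation nc := (@Normc.normc R).
Local Notation acts := (foldr (@act R n)).

Definition comb S (u : 'I_n -> fps) X : vf := fun i => \sum_(t in S) u t * (X t i : fps).

Lemma act_comb S u X f : act (comb S u X) f = \sum_(t in S) u t * act (X t) f.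
Proof.
rewrite /act; under [RHS]eq_bigr do rewrite mulr_sumr.
rewrite exchange_big; apply: eq_bigr => i _ /=.
by rewrite mulr_suml; apply: eq_bigr => t _; rewrite mulrA.
Qed.

Lemma tangent_comb I S u X : ideal I -> (forall t, conv (u t)) ->
  (forall t, tangent_algebra I (X t)) -> tangent_algebra I (comb S u X).
Proof.
move=> hI cu hX; have [_ _ _ hM] := hI; apply/tangent_algebraE; split.
  by move=> i; apply: conv_sum => t _; apply: convM => //; case: (hX t) => + _; apply.
move=> g Ig; rewrite act_comb; apply: ideal_sum => // t _; apply: hM => //.
by have /tangent_algebraE[_] := hX t; apply.
Qed.

(** Gaussian elimination over the local ring. If the values at 0 do not span, some [D] of the
    stabilizer, cleared of its components in [S], keeps a unit in a component [i]; normalized there,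
    it is used to clear that component in the other fields. *)
Lemma maximal_frame I : ideal I -> exists S X, let B := tangent_algebra I in
  [/\ forall s, B (X s), forall s t, s \in S -> t \in S -> X s t = (s == t)%:R :> fps &
     forall D, B D -> forall i, ev0 (D i) = \sum_(t in S) ev0 (D t) * ev0 (X t i)].
Proof.
move=> hI; set B := tangent_algebra I.
have lB : lie_subalgebra B := tangent_lie hI.
have sB := lB.1; have [dB [B0 _]] := sB.
suff H m S X : (n - #|S| <= m)%N -> (forall s, B (X s)) ->
    (forall s t, s \in S -> t \in S -> X s t = (s == t)%:R :> fps) -> exists S X,
    [/\ forall s, B (X s), forall s t, s \in S -> t \in S -> X s t = (s == t)%:R :> fps &
     forall D, B D -> forall i, ev0 (D i) = \sum_(t in S) ev0 (D t) * ev0 (X t i)].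
  by apply: (H n set0 (fun=> vzero R (n:=n))); [exact: leq_subr | by [] | move=> s t; rewrite inE].
elim: m S X => [|m IH] S X hm BX hX.
all: have [?|nh] := pselect (forall D, B D ->
  forall i, ev0 (D i) = \sum_(t in S) ev0 (D t) * ev0 (X t i)); first by exists S, X.
all: have {nh} [D [BD [i hi]]] : exists D, B D /\ exists i,
  ev0 (D i) <> \sum_(t in S) ev0 (D t) * ev0 (X t i) by
    (apply: contrapT => h; apply: nh => D BD i; apply: contrapT => hi; apply: h;
     exists D; split=> //; exists i).
all: pose D' := vadd D (vscale (-1) (comb S D X)).
all: have BD' : B D' by (apply: subspaceB => //; apply: tangent_comb => //; exact: dB).
all: have D's s : s \in S -> D' s = 0 :> fps by
  (move=> sS; rewrite /D' vsubE /comb (bigD1 s) //= hX // eqxx mulr1 big1 ?addr0 ?subrr //;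
   move=> t /andP[tS /negPf ts]; rewrite hX // ts mulr0).
all: have D'i : ev0 (D' i) != 0 by
  (rewrite /D' vsubE rmorphB subr_eq0 /comb rmorph_sum; apply/eqP; move=> e; apply: hi; rewrite e;
   apply: eq_bigr => t _; rewrite rmorphM).
all: have iS : i \notin S by (apply: contraNN D'i => /D's ->; rewrite raddf0).
  (* Base case: [S] already exhausts all indices, so [i] cannot lie outside it. *)
  by have := max_card (mem (i |: S)); rewrite cardsU1 iS card_ord add1n ltnNge -subn_eq0 -leqn0 hm.
have [h ch hD'] := conv_inv (dB _ BD' i) D'i.
have [E [BE Ei Es]] : exists E, [/\ B E, E i = 1 :> fps & forall s, s \in S -> E s = 0 :> fps].
  exists (vmul h D'); split; [exact: tangent_vmul | by rewrite vmulE mulrC |].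
  by move=> s sS; rewrite vmulE D's // mulr0.
(* Subtracting multiples of [E] preserves the old normalization because [E] vanishes in the
   components of [S]. *)
apply: (IH (i |: S) (fun t => if t == i then E else vadd (X t) (vscale (-1) (vmul (X t i) E)))).
- by rewrite cardsU1 iS; lia.
- move=> s; case: ifP => // _; apply: subspaceB => //; apply: tangent_vmul => //.
  exact: dB.
- move=> s t; rewrite !inE; have [->|si] := eqVneq s i; have [->|ti] := eqVneq t i => //=.
  + by move=> _ tS; rewrite Es.
  + by move=> sS _; rewrite vsubE vmulE Ei mulr1 subrr (negPf si).
  + by move=> sS tS; rewrite vsubE vmulE Es // mulr0 subr0 hX.
Qed.

(** * Reordering words of vector fields *)

Section WordReduction.
Variables (B : vf -> Prop) (S : {set 'I_n}) (X : 'I_n -> vf) (F : fps).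
Hypotheses (lB : lie_subalgebra B) (BX : forall s, B (X s)).
Hypothesis spanX : forall D, B D ->
  forall i, ev0 (D i) = \sum_(t in S) ev0 (D t) * ev0 (X t i).
Hypothesis kill : forall a, (forall i, i \notin S -> a i = 0%N) ->
  ev0 (acts F (map X (word a))) = 0.

Let val (l : seq vf) := ev0 (acts F l).
Let inB := words_in B.

(** Two neighbours [D], [E] commute up to the word with $[D,E]$ in their place, which is one letter
    shorter and so has value 0. *)
Let val_swap m : (forall l, (size l < m)%N -> inB l -> val l = 0) ->
  forall p D E r, size (p ++ D :: E :: r) = m -> inB (p ++ D :: E :: r) ->
  val (p ++ D :: E :: r) = val (p ++ E :: D :: r).
Proof.
move=> IH p D E r hs /words_in_cat[Bp [BD [BE Br]]].
apply/eqP; rewrite -subr_eq0 /val -rmorphB /= !foldr_cat -foldr_act_sub /= -act_bracket.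
rewrite -/(acts F (vbracket D E :: r)) -foldr_cat; apply/eqP; apply: IH.
  by move: hs; rewrite !size_cat /=; lia.
by apply/words_in_cat; split=> //; split=> //; apply: lB.2.
Qed.

Let val_move m : (forall l, (size l < m)%N -> inB l -> val l = 0) ->
  forall u p D r, size (p ++ D :: u ++ r) = m -> inB (p ++ D :: u ++ r) ->
  val (p ++ D :: u ++ r) = val (p ++ u ++ D :: r).
Proof.
move=> IH; elim=> [//|E u IHu] p D r hs hB /=.
rewrite (val_swap IH) // -(cat_rcons E p (D :: u ++ r)) IHu ?cat_rcons //.
  by move: hs; rewrite !size_cat /=; lia.
by move: hB => /words_in_cat[Bp [BD [BE Br]]]; apply/words_in_cat.
Qed.

Let val_perm m : (forall l, (size l < m)%N -> inB l -> val l = 0) ->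
  forall s t, perm_eq s t -> size s = m -> val (map X s) = val (map X t).
Proof.
have inX s : inB (map X s) by elim: s => //= s r; split.
move=> IH s t st hs.
pose P u := size u = m /\ val (map X s) = val (map X u).
suff [] : P t by [].
(* Permutations are generated by exchanges of two adjacent blocks; the letters of [s1] are carried
   across [s2] one at a time, behind a growing prefix [p]. *)
apply: (@catCA_perm_ind _ P) st _ => // s1 s2 s3 [hs' e]; split.
  by move: hs'; rewrite !size_cat; lia.
rewrite e !map_cat; suff H p : size (p ++ s1 ++ s2 ++ s3) = m ->
    val (map X (p ++ s1 ++ s2 ++ s3)) = val (map X (p ++ s2 ++ s1 ++ s3)).
  by have := H [::]; rewrite /= !map_cat; apply.
elim: s1 p {hs' e} => [//|x s1 IHs] p hp.
rewrite cat_cons -cat_rcons IHs; last by rewrite cat_rcons.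
rewrite cat_rcons !map_cat /= map_cat (val_move IH) //.
  by rewrite !map_cat.
  by move: hp; rewrite !(size_cat, size_map, size_rcons) /=; rewrite !(size_cat, size_map); lia.
by have := inX (p ++ x :: s2 ++ s1 ++ s3); rewrite !map_cat /= !map_cat.
Qed.

(* A word on fields [D :: u ++ X s] is evaluated at [0], so its head may be replaced by a
   combination of the [X t]; commuting these to the right costs only shorter words. *)
Lemma word_reduction l : words_in B l -> ev0 (acts F l) = 0.
Proof.
move El : (size l) => m; elim/ltn_ind: m l El => m IHm l El Bl.
have IH l' : (size l' < m)%N -> inB l' -> val l' = 0 by move=> hl; apply: (IHm _ hl).
have inX s : inB (map X s) by elim: s => //= s r; split.
suff H u s : all (mem S) s -> (size u + size s)%N = m -> inB u -> val (u ++ map X s) = 0.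
  by have := H l [::] isT; rewrite addn0 /= cats0; apply.
elim: u s => [|D u IHu] s sS hs Bu /=.
  rewrite (val_perm IH (t := word (tally s))); last 2 first.
  - by rewrite perm_sym perm_word.
  - exact: hs.
  apply: kill => i iS; rewrite ffunE; apply/count_memPn; apply: contra iS.
  by move/allP: sS => /[apply].
case: Bu => BD Bu; set G := u ++ map X s.
have BG : inB G by apply/words_in_cat; split=> //; apply: inX.
rewrite /val /= ev0_act; under eq_bigr => i _ do rewrite (spanX BD) mulr_suml.
rewrite exchange_big /= big1 // => t tS.
transitivity (ev0 (D t) * val (X t :: G)).
  by rewrite /val /= ev0_act mulr_sumr; apply: eq_bigr => i _; rewrite mulrA.
have hm : size ([::] ++ X t :: u ++ map X s) = m by rewrite -hs /= size_cat size_map; lia.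
rewrite -[_ :: G]/([::] ++ X t :: u ++ map X s) (val_move IH) //=.
rewrite (IHu (t :: s)) ?mulr0 //=; first by rewrite tS.
by move: hs => /=; lia.
Qed.

End WordReduction.

Definition pds (s : seq 'I_n) f := foldr (@pd R n) f s.

(** Taylor's formula cleared of denominators; at $b = 0$ it identifies the coefficients of [f] with
    derivatives at 0 divided by factorials. *)
Lemma pdsE s f b :
  (mfact b)%:R * pds s f b = (mfact (madd b (tally s)))%:R * f (madd b (tally s)).
Proof.
elim: s b => [|j s IH] b /=.
  have -> : tally [::] = mzero n by apply: mindexP => i; rewrite !ffunE.
  by rewrite maddC madd0.
rewrite pdE mulrA -natrM mulnC -mfact_unit IH.
have -> // : madd (madd b (munit j)) (tally s) = madd b (tally (j :: s)).
by apply: mindexP => i; rewrite !mE !ffunE /= addnA eq_sym.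
Qed.

(** On a function of the coordinates in [S] only, the frame field [X s] acts as $\partial_s$: its
    components outside [S] meet zero derivatives, and this persists for the derivatives of [f]. *)
Lemma acts_pds S X s f :
  (forall s t, s \in S -> t \in S -> X s t = (s == t)%:R :> fps) ->
  all (mem S) s -> (forall j, j \notin S -> pd j f = 0) ->
  acts f (map X s) = pds s f.
Proof.
move=> hX sS hf.
have h j r : j \notin S -> pd j (pds r f) = 0.
  by move=> jS; elim: r => [|i r IH] /=; [exact: hf | rewrite pdC IH raddf0].
elim: s sS => //= s r IH /andP[sS rS]; rewrite IH // /act (bigD1 s) //=.
rewrite hX // eqxx mul1r big1 ?addr0 // => i /negPf si.
have [iS|iS] := boolP (i \in S); last by rewrite h // mulr0.
by rewrite hX // eq_sym si mul0r.
Qed.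

(** One more field is a sum of [n] products of a component with a derivative, so the weight rises by
    2 and the constant by $n(2m+1)KM \le 2nMK(m+1)$; the factors $m+1$ accumulate to the
    factorial. *)
Lemma acts_maj X (K M D0 : R) f s : 1 <= K -> 1 <= M -> 1 <= D0 ->
  (forall t i, maj 0 K M (X t i)) -> maj 0 K D0 f ->
  maj (2 * size s) K (D0 * (2 * n%:R * M * K) ^+ size s * (size s)`!%:R) (acts f (map X s)).
Proof.
move=> K1 M1 D1 hX hf; elim: s => [|t s IH] /=; first by rewrite expr0 !mulr1.
set m := size s in IH *; set c := _ * _ * _ in IH.
have n0 : 0 <= n%:R :> R by apply: ler0n.
have P0 : 0 <= (2 * n%:R * M * K) ^+ m :> R by rewrite exprn_ge0 // !mulr_ge0 //; lra.
have c0 : 0 <= c by rewrite /c !mulr_ge0 ?ler0n //; lra.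
have h : maj (2 * m).+2 K (n%:R * ((2 * m).+1%:R * K * c * M)) (act (X t) (acts f (map X s))).
  have es : size (index_enum 'I_n) = n by rewrite -[RHS]size_enum_ord enumT; congr size; rewrite unlock.
  rewrite -[X in X%:R * _]es; apply: maj_sum => i; rewrite [_ * pd _ _]mulrC; apply: majM => //; try lra.
    by rewrite !mulr_ge0 ?ler0n //; lra.
  by apply: maj_pd => //; lra.
rewrite mulnS; apply: majW h; try lra.
  by rewrite !mulr_ge0 ?ler0n //; lra.
rewrite factS natrM exprS.
have -> : n%:R * ((2 * m).+1%:R * K * c * M) = (n%:R * K * c * M) * (2 * m).+1%:R :> R by ring.
have -> : D0 * (2 * n%:R * M * K * (2 * n%:R * M * K) ^+ m) * (m.+1%:R * m`!%:R) =
  (n%:R * K * c * M) * (2 * m.+1)%:R :> R by rewrite /c natrM; ring.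
apply: ler_wpM2l; first by rewrite !mulr_ge0 //; lra.
by rewrite ler_nat; lia.
Qed.

(* In a frame with [X s (x_t) = delta_st], flowing from [0] along the frame for times [x_s]
   parametrizes the orbit as the graph of these functions of the coordinates in [S]. *)
Definition orbit_graph S X (j : 'I_n) : fps := fun a =>
  if [forall i, (i \notin S) ==> (a i == 0%N)]
  then ev0 (acts (Xvar R j) (map X (word a))) / (mfact a)%:R else 0.

Lemma conv_orbit_graph S X j : (forall s, in_Der (X s)) -> conv (orbit_graph S X j).
Proof.
move=> cX.
have [K [D0 [K1 D1 hx]]] := convergent_maj (conv_Xvar R j).
have [K' [M [K1' M1 hX]]] := convergent_maj_fam (fun t : 'I_n * 'I_n => cX t.1 t.2).
pose L := K + K'; pose N := 2 * n%:R * M * L.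
have n0 : 0 <= n%:R :> R by apply: ler0n.
have N0 : 0 <= N by rewrite /N /L !mulr_ge0 //; lra.
have L1 : 1 <= L by rewrite /L; lra.
have {}hX t i : maj 0 L M (X t i).
  by apply: (majW _ _ _ _ (hX (t, i))); rewrite /L; lra.
have {}hx : maj 0 L D0 (Xvar R j) by apply: (majW _ _ _ _ hx); rewrite /L; lra.
apply: (@maj_convergent _ _ 0 (1 + N * n%:R) D0); first by rewrite lerDl mulr_ge0.
move=> a; rewrite bw0 mulr1 /orbit_graph; case: ifP => _; last first.
  by rewrite Normc.normc0 mulr_ge0 ?exprn_ge0 ?addr_ge0 ?mulr_ge0 //; lra.
rewrite Normc.normcM Normc.normcV nc_nat.
rewrite ler_pdivrMr ?ltr0n ?mfact_gt0 //.
(* At exponent 0 the weight is 1 despite its growing index, leaving $D_0 N^{|a|}|a|!$, to be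
   compared with $a!$. *)
have := acts_maj (word a) L1 M1 D1 hX hx (mzero n).
rewrite mdeg0 expr0 mulr1 size_word (_ : bw _ _ = 1%N); last first.
  by apply: big1 => i _; rewrite mE binn.
rewrite mulr1 -/N => /le_trans; apply.
have P0 : 0 <= D0 * N ^+ mdeg a by rewrite mulr_ge0 ?exprn_ge0 //; lra.
apply: le_trans (_ : _ <= D0 * N ^+ mdeg a * (n ^ mdeg a * mfact a)%:R) _.
  by apply: ler_wpM2l => //; rewrite ler_nat fact_leq_mfact.
rewrite natrM natrX mulrA; apply: ler_wpM2r => //.
rewrite -mulrA -exprMn; apply: ler_wpM2l; first by lra.
have Nn : 0 <= N * n%:R by apply: mulr_ge0.
by apply: lerXn2r; rewrite ?nnegrE; lra.
Qed.

Lemma pd_orbit_graph S X j l : l \notin S -> pd l (orbit_graph S X j) = 0.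
Proof.
move=> lS; apply: funext => a; rewrite pdE /orbit_graph; case: forallP => [/(_ l)|_].
  by rewrite lS !mE eqxx addn1.
by rewrite mulr0.
Qed.

Lemma word0 : word (mzero n) = [::].
Proof. by apply/eqP; rewrite -size_eq0 size_word mdeg0. Qed.

Lemma ev0_orbit_graph S X j : ev0 (orbit_graph S X j) = 0.
Proof.
rewrite {1}/ev0 /orbit_graph; case: ifP => // _.
by rewrite word0 /= ev0_Xvar mul0r.
Qed.

(** The graph function is defined by prescribing these Taylor coefficients: frame fields act on it
    as partial derivatives, so both terms of the difference take the same value at 0. *)
Lemma kill_orbit_graph S X j a :
  (forall s t, s \in S -> t \in S -> X s t = (s == t)%:R :> fps) ->
  (forall i, i \notin S -> a i = 0%N) ->
  ev0 (acts (Xvar R j - orbit_graph S X j) (map X (word a))) = 0.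
Proof.
move=> hX ha; have wS : all (mem S) (word a).
  apply/allP => i; rewrite -has_pred1 has_count count_word.
  by apply: contraTT => /ha ->.
rewrite foldr_act_sub rmorphB /= (acts_pds hX wS (@pd_orbit_graph S X j)).
apply/eqP; rewrite subr_eq0; apply/eqP; symmetry.
have := pdsE (word a) (orbit_graph S X j) (mzero n).
rewrite tally_word madd0 {1}/mfact big1 ?mul1r => [|i _]; last by rewrite mE.
rewrite /ev0 => ->; rewrite /orbit_graph.
have -> : [forall i, (i \notin S) ==> (a i == 0%N)].
  by apply/forallP => i; apply/implyP => /ha ->.
by rewrite mulrC divfK // pnatr_eq0 -lt0n mfact_gt0.
Qed.

(** Successive division by the $x_j - g_j$. Since the $g_j$ depend only on coordinates in [S], each
    division keeps the remainder free of the variables already eliminated. *)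
Lemma graph_reduction S (g : 'I_n -> fps) F (r : seq 'I_n) :
  (forall j, conv (g j)) -> (forall j, ev0 (g j) = 0) ->
  (forall j l, l \notin S -> pd l (g j) = 0) -> conv F -> {subset r <= ~: S} ->
  exists (Q : 'I_n -> fps) (Rm : fps), [/\ forall j, conv (Q j), conv Rm,
    F = \sum_(j in ~: S) Q j * (Xvar R j - g j) + Rm & forall j, j \in r -> pd j Rm = 0].
Proof.
move=> cg g0 gS cF; elim: r => [|j r IH] rS.
  exists (fun=> 0), F; split=> //; first by move=> _; apply: conv0.
  by rewrite big1 ?add0r // => i _; rewrite mul0r.
have jS : j \in ~: S by apply: rS; rewrite mem_head.
have [|Q [R1 [cQ cR eF hR]]] := IH; first by move=> l lr; apply: rS; rewrite inE lr orbT.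
have jS' : j \notin S by rewrite -in_setC.
have [Q0 [R2 [cQ0 cR2 e1 e2 e3]]] := graph_division (cg j) (g0 j) (gS j j jS') cR.
exists (fun i => Q i + (i == j)%:R * Q0), R2; split=> //.
- by move=> i; apply: convD => //; apply: convM => //; apply: conv_nat.
- rewrite {1}eF {1}e1 addrA; congr (_ + _).
  under [RHS]eq_bigr => i _ do rewrite mulrDl.
  rewrite big_split /=; congr (_ + _).
  rewrite (bigD1 j) //= eqxx mul1r big1 ?addr0; first by rewrite mulrC.
  by move=> i /andP[_ /negPf ->]; rewrite !mul0r.
- move=> l; rewrite inE; have [->|lj] := eqVneq l j; first by [].
  move=> /= lr; apply: e3 => //; last exact: hR.
  by apply: gS; rewrite -in_setC; apply: rS; rewrite inE lr orbT.
Qed.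

Lemma det_neq0P m (M : 'M[C]_m) :
  \det M != 0 <-> forall u : 'rV_m, u *m M = 0 -> u = 0.
Proof.
rewrite -unitfE -unitmxE -row_free_unit; split=> [fM u uM|h].
  by apply: (row_free_inj fM); rewrite uM mul0mx.
rewrite -kermx_eq0; apply/eqP/row_matrixP => i; rewrite row0; apply: h.
by rewrite -row_mul mulmx_ker row0.
Qed.

Lemma smooth_idealE (f : 'I_n -> fps) k g : smooth_ideal f k g <->
  conv g /\ exists2 h : 'I_n -> fps, (forall i, conv (h i)) &
    g = \sum_(i < n | (i < k)%N) h i * f i.
Proof.
split=> -[cg].
  move=> [h [ch e]]; split=> //; exists h => //; apply: funext => a.
  by rewrite e fps_sumE.
move=> [h ch e]; split=> //; exists h; split=> // a.
by rewrite e fps_sumE.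
Qed.

(** [smooth_ideal] takes the first [k] coordinate functions as equations, so the coordinates must be
    renumbered. *)
Lemma indices_outside_first S : exists2 s : 'I_n -> 'I_n, injective s &
  forall i : 'I_n, (i < #|~: S|)%N = (s i \notin S).
Proof.
pose r := enum (~: S) ++ enum S.
have sr : size r = n.
  by rewrite size_cat -!cardE addnC cardsC card_ord.
have ur : uniq r.
  rewrite cat_uniq !enum_uniq andbT /=; apply/hasPn => x.
  by rewrite !mem_enum in_setC negbK.
exists (fun i : 'I_n => nth i r i) => [i j|i].
  rewrite (set_nth_default i) ?sr // => /eqP.
  by rewrite nth_uniq ?sr // => /eqP/val_inj.
rewrite nth_cat -cardE; case: ltnP => hi; symmetry.
  by rewrite -in_setC -(mem_enum (~: S)) mem_nth // -cardE.
apply/negbTE; rewrite negbK -(mem_enum S) mem_nth // -cardE.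
by rewrite ltn_subLR // addnC cardsC card_ord.
Qed.

Theorem orbit_ideal_smooth A : lie_subalgebra A -> exists k (f : 'I_n -> fps),
  [/\ (k <= n)%N, coord_system f & forall F, orbit_ideal A F <-> smooth_ideal f k F].
Proof.
move=> lA; have dA : forall D, A D -> in_Der D := lA.1.1.
have iJ := orbit_ideal_ideal dA; have [cJ J0 JD JM] := iJ.
have [S [X [BX hX spanX]]] := maximal_frame iJ.
have lB := tangent_lie iJ; set B := tangent_algebra _ in BX spanX lB.
have cX s : in_Der (X s) by case: (BX s).
pose g := orbit_graph S X.
have cg j : conv (g j) by apply: conv_orbit_graph.
have gS j l : l \notin S -> pd l (g j) = 0 by apply: pd_orbit_graph.
have g0 j : ev0 (g j) = 0 by apply: ev0_orbit_graph.
have Jg j : orbit_ideal A (Xvar R j - g j).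
  (* The stabilizer [B] contains [A], so vanishing along words in [B] is the stronger claim, and [B]
     contains the frame needed to reduce words. *)
  apply: (@orbit_idealW _ _ A B); first by move=> D AD; apply: tangent_orbit.
  split=> [|l]; first by apply: convB => //; apply: conv_Xvar.
  by apply: (word_reduction lB BX spanX) => a; apply: kill_orbit_graph.
(* The coordinates in [S] are free on the orbit: words in the frame compute all Taylor coefficients
   of such an [F], and they vanish on the orbit ideal. *)
have J_zero F : orbit_ideal A F -> (forall j, j \notin S -> pd j F = 0) -> F = 0.
  move=> JF FS; apply: funext => a; rewrite fps0E.
  have [wS|] := boolP (all (mem S) (word a)); last first.
    rewrite -has_predC => /hasP[j + jS]; rewrite -has_pred1 has_count count_word => aj.
    have := congr1 (fun h : fps => h (msub a (munit j))) (FS j jS).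
    rewrite pdE madd_subK // => /eqP; rewrite mulf_eq0 pnatr_eq0 /= => /eqP //.
  have : ev0 (acts F (map X (word a))) = 0.
    have : orbit_ideal A (acts F (map X (word a))).
      elim: (word a) => //= s w IH; have /tangent_algebraE[_] := BX s; exact.
    by case=> _ /(_ [::] I).
  rewrite (acts_pds hX wS) // /ev0 => h; have := pdsE (word a) F (mzero n).
  rewrite h mulr0 tally_word madd0 => /esym/eqP.
  by rewrite mulf_eq0 pnatr_eq0 eqn0Ngt mfact_gt0 /= => /eqP.
have [s sI sS] := indices_outside_first S.
(* The equations of the graph come first, completed by the coordinates in [S]. *)
pose f i : fps := Xvar R (s i) - (if s i \in S then 0 else g (s i)).
exists #|~: S|, f; split; first by rewrite -[X in (_ <= X)%N]card_ord max_card.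
- split; first by move=> i; apply: convB; [exact: conv_Xvar | case: ifP => _ //; exact: conv0].
  split.
    by move=> i; rewrite -[sval0 _]/(ev0 (f i)) /f rmorphB /= ev0_Xvar; case: ifP => _; rewrite ?g0 ?rmorph0 subrr.
  (* The Jacobian at 0 is block triangular with identity diagonal blocks: columns outside [S] give
     [u1], and the columns in [S] then give the other entries. *)
  apply/det_neq0P => u /rowP uM.
  have {}uM j : \sum_i u 0 i * ((s i == j)%:R - (if s i \in S then 0 else ev0 (pd j (g (s i))))) = 0.
    have := uM j; rewrite !mxE => h; rewrite -[RHS]h; apply: eq_bigr => i _; rewrite !mxE; congr (_ * _).
    rewrite -[sval0 _]/(ev0 (pd j (f i))) /f raddfB /= pd_Xvar rmorphB /= eq_sym rmorph_nat.
    by case: ifP => // _; rewrite !raddf0.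
  have u1 i : s i \notin S -> u 0 i = 0.
    move=> iS; rewrite -(uM (s i)) (bigD1 i) //= eqxx (negPf iS) gS // rmorph0 subr0 mulr1.
    rewrite big1 ?addr0 // => l li; rewrite (inj_eq sI) (negPf li).
    by case: ifP => _; rewrite ?gS // ?rmorph0 subr0 mulr0.
  apply/rowP => i; rewrite mxE; have [iS|] := boolP (s i \in S); last exact: u1.
  rewrite -(uM (s i)) (bigD1 i) //= eqxx iS subr0 mulr1.
  rewrite big1 ?addr0 // => l li; rewrite (inj_eq sI) (negPf li).
  by have [lS|/u1 ->] := boolP (s l \in S); rewrite ?subr0 ?mulr0 ?mul0r.
- move=> F; split=> [JF|/smooth_idealE[_ [h ch ->]]]; last first.
    apply: ideal_sum => // i; rewrite sS => iS; apply: JM => //.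
    by rewrite /f (negPf iS); apply: Jg.
  have cF := cJ _ JF.
  have [|Q [Rm [cQ cR eF hR]]] := graph_reduction (r := enum (~: S)) cg g0 gS cF.
    by move=> i; rewrite mem_enum.
  have JR : orbit_ideal A Rm.
    have -> : Rm = F - \sum_(j in ~: S) Q j * (Xvar R j - g j) by rewrite {1}eF addrC addKr.
    by apply: idealB => //; apply: ideal_sum => // j _; apply: JM.
  have R0 : Rm = 0.
    by apply: J_zero => // j jS; apply: hR; rewrite mem_enum in_setC.
  apply/smooth_idealE; split=> //; exists (fun i => Q (s i)) => //.
  rewrite {1}eF R0 addr0 (reindex_inj sI) /=; apply: eq_big => i.
    by rewrite in_setC sS.
  by rewrite in_setC /f => /negPf ->.
Qed.

End OrbitIdeal.

(** * Tangent algebras of smooth germs *)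

Section SmoothTangentAlgebra.
Variables (R : realType) (n : nat).
Local Notation C := R[i].
Local Notation fps := (fps R n).
Local Notation conv := (@convergent R n).
Local Notation vf := (vfield R n).
Implicit Types (g h p F : fps) (D E c : vf) (A B : vf -> Prop) (I : fps -> Prop).

Definition vpart (l : 'I_n) : vf := fun i => (l == i)%:R : fps.

Lemma act_vpart l g : act (vpart l) g = pd l g.
Proof.
rewrite /act /vpart (bigD1 l) //= eqxx mul1r big1 ?addr0 // => i /negPf il.
by rewrite eq_sym il mul0r.
Qed.

Lemma in_Der_vpart l : in_Der (vpart l).
Proof. by move=> i; apply: conv_nat. Qed.

Lemma tangent_ideal_mul I p c : ideal I -> I p -> in_Der c -> tangent_algebra I (vmul p c).
Proof.
move=> [cI _ _ hM] Ip cc; apply/tangent_algebraE; split.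
  by apply: in_Der_vmul => //; apply: cI.
by move=> g Ig; rewrite act_vmul mulrC; apply: hM => //; apply: conv_act => //; apply: cI.
Qed.

(** A bracket differentiates the coefficient once, so at least one of the two factors [p]
    survives. *)
Lemma bracket_sqr p c b : conv p -> in_Der c -> in_Der b ->
  exists2 c', in_Der c' & vbracket (vmul (p ^+ 2) c) b = vmul p c'.
Proof.
move=> cp cc cb.
exists (vadd (vmul p (vbracket c b)) (vscale (-1) (vmul (2%:R * act b p) c))).
  apply: in_Der_vadd; first by apply: in_Der_vmul => //; apply: in_Der_bracket.
  apply: in_Der_vscale; apply: in_Der_vmul => //; apply: convM; first exact: conv_nat.
  exact: conv_act.
apply: vfieldP => i; rewrite vbracketE !vmulE vsubE !vmulE vbracketE act_vmul !actM expr2; ring.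
Qed.

(** Bracketing with a coordinate field differentiates the components up to sign, which moves a
    nonzero coefficient down to the origin. *)
Lemma lie_ideal_nonvanishing (J : vf -> Prop) D (j : 'I_n) a : lie_ideal J -> J D ->
  D j a != 0 -> exists2 D', J D' & ev0 (D' j) != 0.
Proof.
move=> [sJ brJ]; move Em : (mdeg a) => m; elim: m a D Em => [|m IH] a D Em JD Da.
  by exists D => //; move: Da; have /eqP -> : a == mzero n by rewrite -mdeg_eq0 Em.
have [|l al] := @mdeg_gt0 n a; first by rewrite Em.
apply: (IH (msub a (munit l)) (vbracket D (vpart l))).
- by have := mdegD (msub a (munit l)) (munit l); rewrite madd_subK // Em mdeg_unit; lia.
- by apply: brJ => //; apply: in_Der_vpart.
- rewrite vbracketE act_vpart fpsDE fpsNE pdE madd_subK // /vpart -polC_nat act_polC fps0E sub0r.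
  by rewrite oppr_eq0 mulf_neq0 // pnatr_eq0.
Qed.

Lemma balanced_tangent I f m : ideal I -> (forall g, I g -> ev0 g = 0) ->
  I f -> ev0 (pd m f) != 0 -> balanced (tangent_algebra I).
Proof.
move=> iI I0 If fm; have [cI _ _ hM] := iI; have cf := cI _ If.
split; first exact: tangent_lie.
split.
  move=> J iJ JI D JD; apply: contrapT => D0.
  have [j [a Da]] : exists j a, D j a != 0.
    apply: contrapT => h; apply: D0 => j a; apply/eqP; apply: contrapT => /negP Da.
    by apply: h; exists j, a.
  have [D' JD' D'j] := lie_ideal_nonvanishing iJ JD Da.
  (* With $b = x_j\partial_m$, the value of $[D',b](f)$ at 0 is $D'_j(0)\,\partial_m f(0) \ne 0$,
     whereas a tangent field maps [f] into [I], which vanishes at 0. *)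
  pose b := vmul (Xvar R j) (vpart m).
  have cb : in_Der b by apply: in_Der_vmul; [exact: conv_Xvar | exact: in_Der_vpart].
  have /JI/tangent_algebraE[_ /(_ f If)/I0] := iJ.2 _ b JD' cb.
  rewrite act_bracket !act_vmul !act_vpart actM act_Xvar rmorphB rmorphD !rmorphM /= ev0_Xvar.
  rewrite !mul0r subr0 addr0 => /eqP; rewrite mulf_eq0 (negPf fm) orbF.
  by apply/negP.
have f0 : f != 0 by apply: contraNneq fm => ->; rewrite !raddf0.
(* The fourth power survives two brackets: they leave the factors $f^2$ and then $f$, still in
   [I]. *)
exists (vmul ((f ^+ 2) ^+ 2) (vpart m)); split; last split; last split.
- rewrite expr2 expr2 -!mulrA; apply: tangent_ideal_mul => //; last exact: in_Der_vpart.
  by rewrite mulrC; apply: hM => //; do ?apply: convM.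
- move=> /veqP/(congr1 (fun D : vf => D m)) /eqP; rewrite vmulE /vpart eqxx mulr1.
  by apply/negP; do 2!apply: sqr_neq0.
- move=> b cb.
  have [c1 cc1 ->] := bracket_sqr (convX 2 cf) (in_Der_vpart m) cb.
  rewrite expr2; apply: tangent_ideal_mul => //; exact: hM.
- move=> b c cb cc.
  have [c1 cc1 ->] := bracket_sqr (convX 2 cf) (in_Der_vpart m) cb.
  have [c2 cc2 ->] := bracket_sqr cf cc1 cc.
  exact: tangent_ideal_mul.
Qed.

(** * Coordinate systems and their dual fields *)

Section CoordinateSystem.
Variables (f : 'I_n -> fps) (k : nat).
Hypothesis coord_f : coord_system f.

Let cf i : conv (f i). Proof. by case: coord_f => h _; apply: h. Qed.
Let f0 i : ev0 (f i) = 0. Proof. by case: coord_f => _ [h _]; apply: h. Qed.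

Lemma smooth_ideal_ideal : ideal (smooth_ideal f k).
Proof.
split.
- by move=> g [].
- apply/smooth_idealE; split; first exact: conv0.
  exists (fun=> 0) => [i|]; first exact: conv0.
  by rewrite big1 // => i _; rewrite mul0r.
- move=> g g' /smooth_idealE[cg [h ch ->]] /smooth_idealE[cg' [h' ch' ->]]; apply/smooth_idealE.
  split; first by apply: convD; apply: conv_sum => i _; apply: convM.
  exists (fun i => h i + h' i) => [i|]; first exact: convD.
  by rewrite -big_split; apply: eq_bigr => i _; rewrite mulrDl.
- move=> p g cp /smooth_idealE[cg [h ch ->]]; apply/smooth_idealE.
  split; first by apply: convM => //; apply: conv_sum => i _; apply: convM.
  exists (fun i => p * h i) => [i|]; first exact: convM.
  by rewrite mulr_sumr; apply: eq_bigr => i _; rewrite mulrA.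
Qed.

Lemma smooth_ideal_gen (i : 'I_n) : (i < k)%N -> smooth_ideal f k (f i).
Proof.
move=> ik; apply/smooth_idealE; split=> //; exists (fun j => (j == i)%:R) => [j|].
  exact: conv_nat.
rewrite (bigD1 i) //= eqxx mul1r big1 ?addr0 // => j /andP[_ /negPf ->].
by rewrite mul0r.
Qed.

Lemma smooth_ideal_ev0 g : smooth_ideal f k g -> ev0 g = 0.
Proof.
move=> /smooth_idealE[_ [h _ ->]]; rewrite rmorph_sum big1 // => i _.
by rewrite rmorphM /= f0 mulr0.
Qed.

Lemma coord_independent (u : 'I_n -> C) :
  (forall j, \sum_i u i * ev0 (pd j (f i)) = 0) -> forall i, u i = 0.
Proof.
move=> h i; case: coord_f => _ [_ /det_neq0P /(_ (\row_i u i))].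
have -> : \row_i u i *m \matrix_(i, j) sval0 (sderiv j (f i)) = 0.
  by apply/rowP => j; rewrite !mxE -[RHS](h j); apply: eq_bigr => l _; rewrite !mxE.
by move=> /(_ erefl)/rowP/(_ i); rewrite !mxE.
Qed.

Lemma coord_gradient i : exists m, ev0 (pd m (f i)) != 0.
Proof.
apply: contrapT => h; have : (i == i)%:R = 0 :> C; last by move/eqP; rewrite eqxx oner_eq0.
apply: (@coord_independent (fun l => (l == i)%:R)) => j.
rewrite (bigD1 i) //= eqxx mul1r big1 ?addr0 => [|l /negPf ->]; last by rewrite mul0r.
by apply/eqP; apply: contrapT => /negP hj; apply: h; exists j.
Qed.

Let Jac : 'M[fps]_n := \matrix_(i, j) pd j (f i).
Let jac := \det Jac.

Lemma ev0_jac : ev0 jac != 0.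
Proof.
case: coord_f => _ [_]; rewrite /jac -det_map_mx.
by congr (\det _ != 0); apply/matrixP => i j; rewrite !mxE.
Qed.

(* [jac] times the coordinate field [d/df_l]; working with the adjugate avoids inverting the
   Jacobian. *)
Definition dual_field (l : 'I_n) : vf := fun i => \adj Jac i l.

Lemma in_Der_dual l : in_Der (dual_field l).
Proof. by move=> i; apply: conv_adj => j m; rewrite mxE; apply: conv_pd. Qed.

Lemma act_dual l i : act (dual_field l) (f i) = jac * (i == l)%:R.
Proof.
have := congr1 (fun M : 'M[fps]_n => M i l) (mul_mx_adj Jac).
rewrite !mxE /jac mulr_natr => <-; apply: eq_bigr => j _.
by rewrite mulrC [Jac i j]mxE.
Qed.

Lemma chain_rule j g : jac * pd j g = \sum_l pd j (f l) * act (dual_field l) g.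
Proof.
have e i : \sum_l pd j (f l) * (dual_field l i : fps) = (i == j)%:R * jac.
  have := congr1 (fun M : 'M[fps]_n => M i j) (mul_adj_mx Jac).
  rewrite !mxE /jac mulr_natl => <-; apply: eq_bigr => l _.
  by rewrite mulrC [Jac l j]mxE.
under eq_bigr => l _ do rewrite /act mulr_sumr.
rewrite exchange_big /=.
transitivity (\sum_i (i == j)%:R * jac * pd i g).
  rewrite (bigD1 j) //= eqxx mul1r big1 ?addr0 // => i /negPf ->.
  by rewrite !mul0r.
by apply: eq_bigr => i _; rewrite -e mulr_suml; apply: eq_bigr => l _; rewrite mulrA.
Qed.

Lemma gradient_eq0 g : (forall l, ev0 (act (dual_field l) g) = 0) -> forall j, ev0 (pd j g) = 0.
Proof.
move=> h j; have := congr1 (@ev0 R n) (chain_rule j g).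
have -> : ev0 (\sum_l pd j (f l) * act (dual_field l) g) = 0.
  by rewrite rmorph_sum big1 // => l _; rewrite rmorphM /= h mulr0.
by rewrite rmorphM => /eqP; rewrite mulf_eq0 (negPf ev0_jac) => /eqP.
Qed.

Lemma dual_tangent (l : 'I_n) : (k <= l)%N -> tangent_algebra (smooth_ideal f k) (dual_field l).
Proof.
move=> kl; have iI := smooth_ideal_ideal; have [_ _ hD hM] := iI.
apply/tangent_algebraE; split; first exact: in_Der_dual.
move=> g /smooth_idealE[_ [h ch ->]]; rewrite act_sum; apply: ideal_sum => //= i ik.
have -> : act (dual_field l) (h i * f i) = act (dual_field l) (h i) * f i.
  rewrite actM act_dual; have [e|_] := eqVneq i l; last by rewrite !mulr0 addr0.
  by move: ik; rewrite e ltnNge kl.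
apply: hM; last exact: smooth_ideal_gen.
by apply: conv_act => //; apply: in_Der_dual.
Qed.

End CoordinateSystem.

Lemma smooth_tangent_balanced (f : 'I_n -> fps) k : coord_system f -> (0 < k <= n)%N ->
  balanced (tangent_algebra (smooth_ideal f k)).
Proof.
move=> cf /andP[k0 kn]; have n0 : (0 < n)%N := leq_trans k0 kn.
have [m hm] := coord_gradient cf (Ordinal n0).
apply: balanced_tangent hm; first exact: smooth_ideal_ideal.
  by move=> g; apply: smooth_ideal_ev0.
exact: smooth_ideal_gen.
Qed.

Lemma balanced_orbit_smooth B : balanced B -> exists k (g : 'I_n -> fps),
  [/\ (0 < k <= n)%N, coord_system g & orbit_ideal B = smooth_ideal g k].
Proof.
move=> bB; have [F JF F0] := balanced_orbit_ideal_neq0 bB.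
have [k [g [kn cg eJ]]] := orbit_ideal_smooth bB.1.
exists k, g; split=> //; last by apply: funext => G; apply: propext.
rewrite kn andbT lt0n; apply: contraNneq F0 => k0.
by have /eJ/smooth_idealE[_ [h _ ->]] := JF; rewrite big1 // => i; rewrite k0.
Qed.

(* With [G = (g_1, .., g_k')] generating [J] and [K f] the part of [G] explained by [f], the
   difference [G - K f] lies in [J] and has zero gradient, hence equals [H G] with [H(0) = 0];
   so [(1 - H) G = K f] and [1 - H] is invertible. *)
Lemma smooth_ideal_sub (f g : 'I_n -> fps) k k' : coord_system f -> coord_system g ->
  (forall i : 'I_n, (i < k)%N -> smooth_ideal g k' (f i)) ->
  (forall (l : 'I_n) F, (k <= l)%N -> smooth_ideal g k' F -> ev0 (act (dual_field f l) F) = 0) ->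
  forall F, smooth_ideal g k' F -> smooth_ideal f k F.
Proof.
move=> cf cg fJ tJ; have [cf0 [f0 _]] := cf; have [cg0 _] := cg.
set J := smooth_ideal g k'; have iJ : ideal J := smooth_ideal_ideal k' cg.
set I := smooth_ideal f k; have iI : ideal I := smooth_ideal_ideal k cf.
have [_ I0 ID IM] := iI; have [cJ _ _ JM] := iJ.
set d := \det (\matrix_(i, j) pd j (f i) : 'M[fps]_n).
have d0 : ev0 d != 0 := ev0_jac cf.
(* The derivative of [g j] with respect to the coordinate [f i] at 0; division by [ev0 d]
   compensates the factor [jac] in the dual fields. *)
pose K j i := polC (ev0 (act (dual_field f i) (g j)) / ev0 d) : fps.
pose r j := g j - \sum_(i < n | (i < k)%N) K j i * f i.
have IK j : I (\sum_(i < n | (i < k)%N) K j i * f i).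
  apply: ideal_sum => // i ik; apply: IM; first exact: conv_polC.
  exact: smooth_ideal_gen.
have Jr (j : 'I_n) : (j < k')%N -> J (r j).
  move=> jk; apply: idealB => //; first exact: smooth_ideal_gen.
  by apply: ideal_sum => // i ik; apply: JM; [exact: conv_polC | exact: fJ].
have r_grad (j : 'I_n) m : (j < k')%N -> ev0 (pd m (r j)) = 0.
  move=> jk; apply: (gradient_eq0 cf) => l.
  have [kl|lk] := leqP k l; first by apply: tJ => //; apply: Jr.
  have e i : act (dual_field f l) (K j i * f i) = (i == l)%:R * (K j l * d).
    rewrite actM act_polC mul0r add0r act_dual -/d.
    by have [->|_] := eqVneq i l; rewrite ?mulr1 ?mul1r // !mulr0 mul0r.
  rewrite /r actB act_sum (eq_bigr _ (fun i _ => e i)) (bigD1 l) //= eqxx mul1r big1 ?addr0.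
    by rewrite rmorphB rmorphM /= ev0_polC divfK // subrr.
  by move=> i /andP[_ /negPf ->]; rewrite mul0r.
have exH (j : 'I_n) : exists Hj : 'I_n -> fps, (j < k')%N ->
    [/\ forall l, conv (Hj l), r j = \sum_(l < n | (l < k')%N) Hj l * g l &
      forall l : 'I_n, (l < k')%N -> ev0 (Hj l) = 0].
  have [jk|jk] := ltnP j k'; last by exists (fun=> 0).
  have /smooth_idealE[_ [h ch e]] := Jr j jk; exists h => _; split=> // l lk.
  (* As the [g l] vanish at 0, the gradient of [r j] there is $\sum_l h_l(0)\nabla g_l(0)$; it is
     zero and the gradients are independent. *)
  have := @coord_independent g cg (fun l : 'I_n => if (l < k')%N then ev0 (h l) else 0).
  move=> /(_ _ l); rewrite lk; apply=> m; rewrite -[RHS](r_grad j m jk) e.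
  rewrite raddf_sum rmorph_sum [RHS]big_mkcond /=; apply: eq_bigr => i _.
  case: ifP => ik; last by rewrite mul0r.
  rewrite pdM rmorphD !rmorphM /=; case: cg => _ [g0 _].
  by rewrite [ev0 (g i)]g0 mulr0 add0r.
have [H hH] := choice exH.
(* $1-H$, padded by the identity to size [n]; [G] is padded by zeros accordingly. *)
pose T : 'M[fps]_n := \matrix_(j, l) ((j == l)%:R - (if (j < k')%N && (l < k')%N then H j l else 0)).
pose G : 'cV[fps]_n := \col_l (if (l < k')%N then g l else 0).
have cT i j : conv (T i j).
  rewrite mxE; apply: convB; first exact: conv_nat.
  by case: ifP => [/andP[ik jk]|_]; [case: (hH i ik) | exact: conv0].
have ITG j : I ((T *m G) j 0).
  rewrite mxE; under eq_bigr => l _ do rewrite !mxE mulrBl.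
  rewrite sumrB (bigD1 j) //= eqxx mul1r [X in _ + X - _]big1 ?addr0; last first.
    by move=> l /negPf lj; rewrite eq_sym lj mul0r.
  have [jk|jk] := ltnP j k'; last by rewrite big1 ?subr0 // => l _; rewrite mul0r.
  have [_ e _] := hH j jk.
  have -> : \sum_(l < n) (if true && (l < k')%N then H j l else 0) * (if (l < k')%N then g l else 0) = r j.
    rewrite e [RHS]big_mkcond /=; apply: eq_bigr => l _.
    by case: ifP; rewrite ?mul0r.
  by rewrite /r opprB addrC subrK.
(* [T] is the identity at 0, so its determinant is a unit. *)
have [e ce de] : exists2 e : fps, conv e & \det T * e = 1.
  apply: conv_inv; first exact: conv_det.
  rewrite -det_map_mx (_ : map_mx _ _ = 1%:M) ?det1 ?oner_eq0 //.
  apply/matrixP => i j; rewrite !mxE rmorphB rmorph_nat /=.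
  case: ifP => [/andP[ik jk]|_]; last by rewrite rmorph0 subr0.
  by case: (hH i ik) => _ _ ->; rewrite ?subr0.
have Ig (j : 'I_n) : (j < k')%N -> I (g j).
  move=> jk; have eG : g j = (e : fps) * (\det T * G j 0) by rewrite mxE jk mulrA [e * _]mulrC de mul1r.
  rewrite eG; apply: (IM) => //.
  (* Cramer's rule recovers [G] from [T *m G], whose entries lie in [I]. *)
  have -> : \det T * G j 0 = (\adj T *m (T *m G)) j 0 by rewrite mulmxA mul_adj_mx mul_scalar_mx [RHS]mxE.
  rewrite mxE; apply: ideal_sum => // l _; apply: IM => //; exact: conv_adj.
move=> F /smooth_idealE[_ [h ch ->]]; apply: ideal_sum => // i ik.
by apply: IM => //; apply: Ig.
Qed.

Lemma smooth_tangent_maximal (f : 'I_n -> fps) k : coord_system f ->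
  forall B, balanced B -> (forall D, tangent_algebra (smooth_ideal f k) D -> B D) ->
  forall D, B D -> tangent_algebra (smooth_ideal f k) D.
Proof.
move=> cf B bB AB D BD; have dB : forall E, B E -> in_Der E := bB.1.1.1.
have [k' [g [/andP[k0 kn] cg eJ]]] := balanced_orbit_smooth bB.
have iJ := orbit_ideal_ideal dB; have [cJ _ _ JM] := iJ.
have J0 F : orbit_ideal B F -> ev0 F = 0 by case=> _ /(_ [::] I).
have Jact E F : tangent_algebra (smooth_ideal f k) E -> orbit_ideal B F -> orbit_ideal B (act E F).
  by move=> /AB; apply: orbit_ideal_act.
have tJ (l : 'I_n) F : (k <= l)%N -> orbit_ideal B F -> ev0 (act (dual_field f l) F) = 0.
  by move=> kl JF; apply: J0; apply: Jact => //; apply: dual_tangent.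
have fJ (l : 'I_n) : (l < k)%N -> orbit_ideal B (f l).
  (* The first equation of the orbit of [B] has order one, so some dual field maps it to a unit;
     [f l] times that field is tangent, and applying it puts [f l] times a unit into the orbit
     ideal. *)
  move=> lk; pose i0 := Ordinal (leq_trans k0 kn).
  have Jg : orbit_ideal B (g i0) by rewrite eJ; apply: smooth_ideal_gen.
  have [i hi] : exists i, ev0 (act (dual_field f i) (g i0)) != 0.
    have [m hm] := coord_gradient cg i0; apply: contrapT => h; move/eqP: hm; apply.
    apply: (gradient_eq0 cf) => i; apply/eqP; apply: contrapT => /negP hi; apply: h.
    by exists i.
  have [e ce de] := conv_inv (conv_act (in_Der_dual cf i) (cJ _ Jg)) hi.
  have -> : f l = e * act (vmul (f l) (dual_field f i)) (g i0).
    by rewrite act_vmul mulrCA [e * _]mulrC de mulr1.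
  apply: JM => //; apply: Jact => //; apply: tangent_ideal_mul; last exact: in_Der_dual.
    exact: smooth_ideal_ideal.
  exact: smooth_ideal_gen.
have -> : smooth_ideal f k = orbit_ideal B.
  apply: funext => F; apply: propext; split; last first.
    by rewrite eJ in tJ fJ *; apply: smooth_ideal_sub.
  move=> /smooth_idealE[_ [h ch ->]]; apply: ideal_sum => // i ik.
  by apply: JM => //; apply: fJ.
exact: tangent_orbit.
Qed.

End SmoothTangentAlgebra.

Theorem theorem1 (R : realType) (n : nat) (A : vfield R n -> Prop) :
  lie_subalgebra A ->
  (is_smooth_tangent_algebra A <-> maximal_balanced A).
Proof.
move=> lA; split=> [[k [kn [f [cf eA]]]]|[bA maxA]].
  have -> : A = tangent_algebra (smooth_ideal f k) by apply: funext => D; apply: propext.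
  by split; [exact: smooth_tangent_balanced | exact: smooth_tangent_maximal].
have [k [g [kn cg eJ]]] := balanced_orbit_smooth bA.
exists k; split=> //; exists g; split=> // D.
have AT E : A E -> tangent_algebra (smooth_ideal g k) E.
  by move=> AE; rewrite -eJ; apply: tangent_orbit => //; case: lA => -[].
by split; [exact: AT | apply: maxA => //; exact: smooth_tangent_balanced].
Qed.
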